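(* Let $\mathcal G$ be a finite groupoid and $\theta\in Z^2(\mathcal G,U(1))$ a two-cocycle. Then the character map $F\mapsto\chi_F$ induces an isomorphism of inner product spaces $$\chi\colon\mathrm{Rep}^\theta(\mathcal G)\otimes\mathbb C\xrightarrow{\ \simeq\ }\Gamma_{\Lambda\mathcal G}(\tau(\theta)_{\mathbb C}).$$
   Context: A finite groupoid is a category with finitely many objects and morphisms, all invertible. Two-cocycles. A (normalized) two-cocycle $\theta\in Z^2(\mathcal G,U(1))$ assigns to each composable pair $x_2\xleftarrow{g_2}x_1\xleftarrow{g_1}x_0$ an element $\theta([g_2|g_1])\in U(1)$, equal to $1$ if $g_1$ or $g_2$ is an identity, such that $\theta([g_2|g_1])\,\theta([g_3g_2|g_1])^{-1}\,\theta([g_3|g_2g_1])\,\theta([g_3|g_2])^{-1}=1$ for all composable triples. Twisted representations. A $\theta$-twisted representation $F$ of $\mathcal G$ assigns to each object $x$ a finite-dimensional complex vector space $F(x)$ and to each morphism $g\colon x_1\to x_2$ a linear map $F(g)\colon F(x_1)\to F(x_2)$ such that $F(\mathrm{id}_x)=\mathrm{id}$ and $F(g_2)F(g_1)=\theta([g_2|g_1])F(g_2\circ g_1)$ for composable $g_2,g_1$. A morphism $T\colon F\Rightarrow F'$ is a family of linear maps $T(x)\colon F(x)\to F'(x)$ with $T(y)F(g)=F'(g)T(x)$ for all $g\colon x\to y$. $\mathrm{Rep}^\theta(\mathcal G)$ is the Grothendieck group of the category of $\theta$-twisted representations; the inner product on $\mathrm{Rep}^\theta(\mathcal G)\otimes\mathbb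 C$ is the sesquilinear extension (conjugate-linear in the first variable) of $([F_1],[F_2])\mapsto\dim\mathrm{Hom}(F_1,F_2)$. Loop groupoid. $\Lambda\mathcal G$ has as objects all self-morphisms $\gamma\in\mathrm{Mor}_{\mathcal G}(x,x)$ and a morphism $g\colon\gamma\to g\gamma g^{-1}$ for each $\gamma\in\mathrm{Mor}_{\mathcal G}(x,x)$ and $g\in\mathrm{Mor}_{\mathcal G}(x,y)$, with composition from $\mathcal G$. Transgressed line bundle. $\tau(\theta)\in Z^1(\Lambda\mathcal G,U(1))$ assigns to the morphism $g\colon\gamma\to g\gamma g^{-1}$ the value $\tau(\theta)([g]\gamma)=\theta([g\gamma g^{-1}|g])/\theta([g|\gamma])$. $\Gamma_{\Lambda\mathcal G}(\tau(\theta)_{\mathbb C})$ is the space of functions $s\colon\mathrm{Ob}(\Lambda\mathcal G)\to\mathbb C$ with $s(g\gamma g^{-1})=\tau(\theta)([g]\gamma)\,s(\gamma)$ for all such morphisms. Its inner product is $\langle s_1,s_2\rangle:=\int_{\Lambda\mathcal G}\overline{s_1}s_2$, where for a function $\beta$ on the objects of a finite groupoid $\mathcal H$ constant on connected components $\int_{\mathcal H}\beta:=\sum_{x}\beta(x)/|x\to|$, with $|x\to|$ the number of morphisms with source $x$. Character map. $\chi_F(\gamma):=\mathrm{Tr}(F(\gamma))$ for $\gamma\in\mathrm{Ob}(\Lambda\mathcal G)$. *)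

(* Defs.v *)
From HB Require Import structures.
From mathcomp Require Import all_boot all_order all_algebra.
From mathcomp Require Import generic_quotient ring_quotient.
From mathcomp Require Import boolp reals complex freeg ring.

Set Implicit Arguments.
Unset Strict Implicit.
Unset Printing Implicit Defensive.

Import Order.TTheory GRing.Theory Num.Theory.

Local Open Scope ring_scope.
Local Open Scope quotient_scope.

(* [gcomp g2 g1] is "g2 after g1". *)
Record finGroupoid := FinGroupoid {
  gobj :> finType;
  gmor : gobj -> gobj -> finType;
  gid : forall x, gmor x x;
  gcomp : forall x y z, gmor y z -> gmor x y -> gmor x z;
  ginv : forall x y, gmor x y -> gmor y x;
  gcompA : forall x y z t (g3 : gmor z t) (g2 : gmor y z) (g1 : gmor x y),
    gcomp g3 (gcomp g2 g1) = gcomp (gcomp g3 g2) g1;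
  gcomp1g : forall x y (g : gmor x y), gcomp (gid y) g = g;
  gcompg1 : forall x y (g : gmor x y), gcomp g (gid x) = g;
  gcompVg : forall x y (g : gmor x y), gcomp (ginv g) g = gid x;
  gcompgV : forall x y (g : gmor x y), gcomp g (ginv g) = gid y }.

Arguments gid {_} x.
Arguments gcomp {_ x y z} g2 g1.
Arguments ginv {_ x y} g.

Section LoopGroupoid.
Variable G : finGroupoid.

(* Objects are pairs (x, gamma : x -> x); the morphisms gamma -> gamma' are the
   g with g gamma g^-1 = gamma'. *)
Definition loop_obj : finType := {x : G & gmor x x}.

Definition loop_mor (a b : loop_obj) : finType :=
  {g : gmor (tag a) (tag b) |
    gcomp (gcomp g (tagged a)) (ginv g) == tagged b}.

Lemma loop_morE (a b : loop_obj) (g : loop_mor a b) :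
  gcomp (val g) (tagged a) = gcomp (tagged b) (val g).
Proof.
case: g => g /= /eqP <-; by rewrite -!gcompA gcompVg gcompg1.
Qed.

Lemma loop_morP (a b : loop_obj) (g : gmor (tag a) (tag b)) :
  gcomp g (tagged a) = gcomp (tagged b) g ->
  gcomp (gcomp g (tagged a)) (ginv g) == tagged b.
Proof. by move=> ->; rewrite -gcompA gcompgV gcompg1. Qed.

Lemma loop_id_proof (a : loop_obj) :
  gcomp (gcomp (gid (tag a)) (tagged a)) (ginv (gid (tag a))) == tagged a.
Proof. by apply: loop_morP; rewrite gcomp1g gcompg1. Qed.

Lemma loop_comp_proof (a b c : loop_obj) (h : loop_mor b c) (g : loop_mor a b) :
  gcomp (gcomp (gcomp (val h) (val g)) (tagged a)) (ginv (gcomp (val h) (val g)))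
    == tagged c.
Proof.
by apply: loop_morP; rewrite -gcompA loop_morE gcompA loop_morE gcompA.
Qed.

Lemma loop_inv_proof (a b : loop_obj) (g : loop_mor a b) :
  gcomp (gcomp (ginv (val g)) (tagged b)) (ginv (ginv (val g))) == tagged a.
Proof.
apply: loop_morP.
rewrite -[LHS]gcompg1 -(gcompgV (val g)) gcompA -[X in gcomp X _]gcompA.
by rewrite -loop_morE !gcompA gcompVg gcomp1g.
Qed.

Definition loop_id a : loop_mor a a := Sub (gid (tag a)) (loop_id_proof a).
Definition loop_comp a b c (h : loop_mor b c) (g : loop_mor a b) :
  loop_mor a c := Sub (gcomp (val h) (val g)) (loop_comp_proof h g).
Definition loop_inv a b (g : loop_mor a b) : loop_mor b a :=
  Sub (ginv (val g)) (loop_inv_proof g).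

Definition loop_groupoid : finGroupoid.
Proof.
refine (@FinGroupoid loop_obj loop_mor loop_id loop_comp loop_inv _ _ _ _ _).
- by move=> *; apply: val_inj; rewrite /= gcompA.
- by move=> *; apply: val_inj; rewrite /= gcomp1g.
- by move=> *; apply: val_inj; rewrite /= gcompg1.
- by move=> *; apply: val_inj; rewrite /= gcompVg.
- by move=> *; apply: val_inj; rewrite /= gcompgV.
Defined.

End LoopGroupoid.

(* Throughout, [R] is a model of the real numbers, [R[i]] its complexification,
   and U(1) is the set of complex numbers of norm 1. *)
Record cocycle1 (R : realType) (H : finGroupoid) := Cocycle1 {
  c1val : forall (x y : H), gmor x y -> R[i];
  c1_norm : forall x y (g : gmor x y), `|c1val g| = 1;
  c1_comp : forall (x y z : H) (g2 : gmor y z) (g1 : gmor x y),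
    c1val (gcomp g2 g1) = c1val g2 * c1val g1 }.

Arguments c1val {R H} _ {x y} g.

Record cocycle2 (R : realType) (G : finGroupoid) := Cocycle2 {
  c2val : forall (x y z : G), gmor y z -> gmor x y -> R[i];
  c2_norm : forall x y z (g2 : gmor y z) (g1 : gmor x y), `|c2val g2 g1| = 1;
  c2_1g : forall x y (g : gmor x y), c2val (gid y) g = 1;
  c2_g1 : forall x y (g : gmor x y), c2val g (gid x) = 1;
  c2_cocycle : forall (x y z t : G)
      (g3 : gmor z t) (g2 : gmor y z) (g1 : gmor x y),
    c2val g2 g1 * (c2val (gcomp g3 g2) g1)^-1 *
    c2val g3 (gcomp g2 g1) * (c2val g3 g2)^-1 = 1 }.

Arguments c2val {R G} _ {x y z} g2 g1.

Section Transgression.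
Variables (R : realType) (G : finGroupoid) (theta : cocycle2 R G).

Lemma c2_neq0 (x y z : G) (g2 : gmor y z) (g1 : gmor x y) : c2val theta g2 g1 != 0.
Proof. by rewrite -normr_eq0 c2_norm oner_eq0. Qed.

Lemma c2_cocycleE (x y z t : G)
    (g3 : gmor z t) (g2 : gmor y z) (g1 : gmor x y) :
  c2val theta g2 g1 * c2val theta g3 (gcomp g2 g1) =
  c2val theta (gcomp g3 g2) g1 * c2val theta g3 g2.
Proof.
have /divr1_eq E := c2_cocycle theta g3 g2 g1.
by rewrite -E; field; rewrite c2_neq0.
Qed.

Definition transgression_val (a b : loop_groupoid G) (g : gmor a b) : R[i] :=
  c2val theta (tagged b) (val g) / c2val theta (val g) (tagged a).

Lemma transgression_norm a b (g : gmor a b) : `|@transgression_val a b g| = 1.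
Proof. by rewrite normf_div !c2_norm divr1. Qed.

Lemma transgression_comp (a b c : loop_groupoid G) (h : gmor b c) (g : gmor a b) :
  transgression_val (gcomp h g) = transgression_val h * transgression_val g.
Proof.
rewrite /transgression_val /=.
have E1 := c2_cocycleE (tagged c) (val h) (val g).
have E2 := c2_cocycleE (val h) (tagged b) (val g).
have E3 := c2_cocycleE (val h) (val g) (tagged a).
rewrite -(loop_morE h) in E1; rewrite -(loop_morE g) in E2.
set A := c2val theta (tagged c) _ in E1 *.
set B := c2val theta (tagged c) (val h) in E1 *.
set D := c2val theta (tagged b) (val g) in E2 *.
set E := c2val theta (val h) (tagged b) in E2 *.
set F := c2val theta (val g) (tagged a) in E3 *.
set K := c2val theta _ (tagged a) in E3 *.
set L := c2val theta (val h) (val g) in E1 E3.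
rewrite [RHS]mulf_div; apply/eqP; rewrite eqr_div ?mulf_neq0 ?c2_neq0//.
have L0 : L != 0 := c2_neq0 _ _.
apply/eqP/(mulfI L0).
transitivity (L * A * (E * F)); first by ring.
transitivity (B * D * (K * L)); last by ring.
rewrite E1 -E3.
transitivity (c2val theta (gcomp (val h) (tagged b)) (val g) * E * (B * F)).
  by ring.
by rewrite -E2; ring.
Qed.

Definition transgression : cocycle1 R (loop_groupoid G) :=
  Cocycle1 transgression_norm transgression_comp.

End Transgression.

Section QuotSpan.
Variables (S : nzRingType) (V : lmodType S) (A : V -> Prop).

(* The submodule spanned by [A], as the intersection of all submodules that
   contain [A]; [quot_span] is the quotient of [V] by it. *)
Definition in_span : {pred V} := fun x =>
  `[< forall P : V -> Prop, P 0 ->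
      (forall a u v, P u -> P v -> P (a *: u + v)) ->
      (forall u, A u -> P u) -> P x >].

Lemma in_spanP x : reflect (forall P : V -> Prop, P 0 ->
      (forall a u v, P u -> P v -> P (a *: u + v)) ->
      (forall u, A u -> P u) -> P x) (x \in in_span).
Proof. exact: asboolP. Qed.

Lemma in_span_submod : submod_closed in_span.
Proof.
split; first by apply/in_spanP.
move=> a u v /in_spanP Hu /in_spanP Hv; apply/in_spanP => P P0 PL PA.
by apply: (PL); [apply: Hu | apply: Hv].
Qed.

HB.instance Definition _ := GRing.isSubmodClosed.Build S V in_span in_span_submod.

Definition quot_span : Type := Quotient.quot in_span.
HB.instance Definition _ := GRing.Zmodule.on quot_span.

Definition quot_pi (x : V) : quot_span := \pi_(Quotient.quot in_span) x.

Lemma quot_piE x y : quot_pi x = quot_pi y <-> x - y \in in_span.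
Proof.
rewrite Quotient.idealrBE; split => [E|/eqP]; [exact/eqP|exact].
Qed.

Lemma quot_pi_surj q : exists x, q = quot_pi x.
Proof. by exists (repr q); rewrite /quot_pi reprK. Qed.

Lemma quot_pi_zmod_morphism : zmod_morphism quot_pi.
Proof.
move=> x y; rewrite /quot_pi.
exact: (raddfB (\pi_(Quotient.quot in_span) : {additive V -> Quotient.quot in_span})).
Qed.
HB.instance Definition _ := GRing.isZmodMorphism.Build V quot_span quot_pi
  quot_pi_zmod_morphism.

Definition quot_scale (a : S) (q : quot_span) : quot_span :=
  quot_pi (a *: repr (q : Quotient.quot in_span)).

Lemma quot_scale_pi a x : quot_scale a (quot_pi x) = quot_pi (a *: x).
Proof.
apply/quot_piE; rewrite -scalerBr; apply: rpredZ.
by apply/quot_piE; rewrite /quot_pi reprK.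
Qed.

Fact quot_scaleA a b q : quot_scale a (quot_scale b q) = quot_scale (a * b) q.
Proof. by have [x ->] := quot_pi_surj q; rewrite !quot_scale_pi scalerA. Qed.
Fact quot_scale1 : left_id 1 quot_scale.
Proof. by move=> q; have [x ->] := quot_pi_surj q; rewrite quot_scale_pi scale1r. Qed.
Fact quot_scaleDr : right_distributive quot_scale +%R.
Proof.
move=> a p q; have [x ->] := quot_pi_surj p; have [y ->] := quot_pi_surj q.
by rewrite -raddfD !quot_scale_pi scalerDr raddfD.
Qed.
Fact quot_scaleDl q : {morph quot_scale^~ q : a b / a + b}.
Proof.
by move=> a b; have [x ->] := quot_pi_surj q; rewrite !quot_scale_pi scalerDl raddfD.
Qed.
HB.instance Definition _ := GRing.Zmodule_isLmodule.Build S quot_span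
  quot_scaleA quot_scale1 quot_scaleDr quot_scaleDl.

Fact quot_pi_scalable : scalable quot_pi.
Proof. by move=> a x; rewrite -quot_scale_pi. Qed.
HB.instance Definition _ := GRing.isScalable.Build S V quot_span *:%R quot_pi
  quot_pi_scalable.

End QuotSpan.

Lemma freegZ_gen (S : nzRingType) (X : choiceType) (a b : S) (x : X) :
  a *: << b *g x >> = << a * b *g x >> :> {freeg X / S}.
Proof. by apply/eqP/freeg_eqP => y; rewrite coeffZ !coeffU mulrA. Qed.

Section Presented.
Variables (S : nzRingType) (X : choiceType) (A : {freeg X / S} -> Prop).

(* The module with generators [X] and relations [u = 0] for [u] in [A]. *)
Definition pres : Type := quot_span A.
HB.instance Definition _ := GRing.Lmodule.on pres.

Definition pres_gen (x : X) : pres := quot_pi A << x >>.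

Lemma pres_rel (u : {freeg X / S}) : A u -> quot_pi A u = 0.
Proof.
move=> Au; rewrite -(raddf0 (quot_pi A)); apply/quot_piE; rewrite subr0.
by apply/in_spanP => P _ _; apply.
Qed.

Lemma fglift_linear (W : lmodType S) (f : X -> W) : linear (fglift f).
Proof.
pose fA : {additive {freeg X / S} -> W} := HB.pack (fglift f)
  (GRing.isZmodMorphism.Build {freeg X / S} W (fglift f) (lift_is_additive f)).
move=> a u v; rewrite -[fglift f]/(fA : _ -> _) raddfD; congr (_ + _).
rewrite -[u]freeg_sumE scaler_sumr !(raddf_sum fA) scaler_sumr.
by apply: eq_bigr => x _; rewrite /= freegZ_gen !liftU scalerA.
Qed.

Lemma pres_ext (W : lmodType S) (f g : {linear pres -> W}) :
  (forall x, f (pres_gen x) = g (pres_gen x)) -> f =1 g.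
Proof.
move=> fg q; have [u ->] := quot_pi_surj q.
rewrite -[u]freeg_sumE !raddf_sum; apply: eq_bigr => x _.
have -> : << coeff x u *g x >> = coeff x u *: << x >> :> {freeg X / S}.
  by rewrite freegZ_gen mulr1.
by rewrite /= quot_pi_scalable !linearZ /= -/(pres_gen x) fg.
Qed.

Lemma pres_lift (W : lmodType S) (f : X -> W) :
  (forall u, A u -> fglift f u = 0) ->
  exists g : {linear pres -> W}, forall x, g (pres_gen x) = f x.
Proof.
move=> fA.
pose fL : {linear {freeg X / S} -> W} := HB.pack (fglift f)
  (GRing.isLinear.Build S {freeg X / S} W *:%R (fglift f) (fglift_linear f)).
have f_span u : u \in in_span A -> fL u = 0.
  move/in_spanP/(_ (fun u => fL u = 0)); apply; [exact: raddf0 | | exact: fA].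
  by move=> a v w v0 w0; rewrite linearP v0 w0 scaler0 addr0.
pose g (q : pres) : W := fL (repr (q : Quotient.quot (in_span A))).
have gE u : g (quot_pi A u) = fL u.
  apply/eqP; rewrite -subr_eq0 -raddfB; apply/eqP/f_span/quot_piE.
  by rewrite /quot_pi reprK.
have g_lin : linear g.
  move=> a p q; have [u ->] := quot_pi_surj p; have [v ->] := quot_pi_surj q.
  by rewrite -linearP !gE linearP.
pose gL : {linear pres -> W} := HB.pack g
  (GRing.isLinear.Build S pres W *:%R g g_lin).
by exists gL => x; rewrite /= gE /= liftU scale1r.
Qed.
End Presented.

(* Vector space structure on dependent finite products; the library only has
   the non-dependent case. *)
Section DffunVect.
Variable I : finType.

Section Zmod.
Variable V : I -> zmodType.
Local Notation fV := {dffun forall i, V i}.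

Definition dffun_zero : fV := [ffun i => 0].
Definition dffun_opp (f : fV) : fV := [ffun i => - f i].
Definition dffun_add (f g : fV) : fV := [ffun i => f i + g i].

Fact dffun_addA : associative dffun_add.
Proof. by move=> f g h; apply/ffunP => i; rewrite !ffunE addrA. Qed.
Fact dffun_addC : commutative dffun_add.
Proof. by move=> f g; apply/ffunP => i; rewrite !ffunE addrC. Qed.
Fact dffun_add0 : left_id dffun_zero dffun_add.
Proof. by move=> f; apply/ffunP => i; rewrite !ffunE add0r. Qed.
Fact dffun_addN : left_inverse dffun_zero dffun_opp dffun_add.
Proof. by move=> f; apply/ffunP => i; rewrite !ffunE addNr. Qed.

HB.instance Definition _ := GRing.isZmodule.Build fV
  dffun_addA dffun_addC dffun_add0 dffun_addN.
End Zmod.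

Section Lmod.
Variables (K : nzRingType) (V : I -> lmodType K).
Local Notation fV := {dffun forall i, V i}.

Definition dffun_scale (a : K) (f : fV) : fV := [ffun i => a *: f i].

Fact dffun_scaleA a b f : dffun_scale a (dffun_scale b f) = dffun_scale (a * b) f.
Proof. by apply/ffunP => i; rewrite !ffunE scalerA. Qed.
Fact dffun_scale1 : left_id 1 dffun_scale.
Proof. by move=> f; apply/ffunP => i; rewrite !ffunE scale1r. Qed.
Fact dffun_scaleDr : right_distributive dffun_scale +%R.
Proof. by move=> a f g; apply/ffunP => i; rewrite !ffunE scalerDr. Qed.
Fact dffun_scaleDl f : {morph dffun_scale^~ f : a b / a + b}.
Proof. by move=> a b; apply/ffunP => i; rewrite !ffunE scalerDl. Qed.

HB.instance Definition _ := GRing.Zmodule_isLmodule.Build K fV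
  dffun_scaleA dffun_scale1 dffun_scaleDr dffun_scaleDl.
End Lmod.

Section Vect.
Variables (K : nzRingType) (V : I -> vectType K).
Local Notation fV := {dffun forall i, V i}.

Import VectorInternalTheory.

Fact dffun_vect_axiom :
  Vector.axiom (\sum_(j < #|I|) dim (V (enum_val j))) fV.
Proof.
pose fr (f : fV) := \mxrow_(j < #|I|) v2r (f (enum_val j)).
exists fr.
  move=> a f g; apply/mxrowP => j; rewrite submxrowD.
  have subZ (B : 'rV[K]_(\sum_(j < #|I|) dim (V (enum_val j)))) :
      submxrow (a *: B) j = a *: submxrow B j :> 'rV[K]_(dim (V (enum_val j))).
    by apply/rowP => k; rewrite !mxE.
  by rewrite subZ !mxrowK !ffunE linearP.
pose rf (r : 'rV_(\sum_(j < #|I|) dim (V (enum_val j)))) : fV :=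
  [ffun i => ecast k (V k) (enum_rankK i) (r2v (submxrow r (enum_rank i)))].
exists rf => [f | r].
  apply/ffunP => i; rewrite ffunE mxrowK v2rK.
  suff H k l (e : k = l) : ecast m (V m) e (f k) = f l by exact: H.
  by case: _ / e.
apply/mxrowP => j; rewrite mxrowK ffunE.
apply: (canLR r2vK).
suff H k (e : k = j) (e' : enum_val k = enum_val j) :
  ecast l (V l) e' (r2v (submxrow r k)) = r2v (submxrow r j).
  exact: (H _ (enum_valK j)).
by case: _ / e in e' *; rewrite (eq_irrelevance e' erefl).
Qed.

HB.instance Definition _ := Lmodule_hasFinDim.Build K fV dffun_vect_axiom.
End Vect.
End DffunVect.

Import passmx.

Section TwistedRep.
Variables (R : realType) (G : finGroupoid) (theta : cocycle2 R G).

Record twrep := TwRep {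
  tw_sp :> G -> vectType R[i];
  tw_act : forall x y, gmor x y -> 'Hom(tw_sp x, tw_sp y);
  tw_act1 : forall x, tw_act (gid x) = \1%VF;
  tw_actM : forall x y z (g2 : gmor y z) (g1 : gmor x y),
    (tw_act g2 \o tw_act g1)%VF = c2val theta g2 g1 *: tw_act (gcomp g2 g1) }.

Arguments tw_act _ {x y} g.

Definition is_intertwiner (F F' : twrep) (T : forall x, 'Hom(F x, F' x)) : Prop :=
  forall x y (g : gmor x y), (T y \o tw_act F g = tw_act F' g \o T x)%VF.

(* [tw_defect T] has component [T y \o F g - F' g \o T x] at [g : x -> y], so
   that Hom(F, F') is its kernel, see [mem_twHom]. *)
Definition tw_defect (F F' : twrep) (T : {dffun forall x : G, 'Hom(F x, F' x)}) :
    {dffun forall p : {x : G & {y : G & gmor x y}},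
       'Hom(F (tag p), F' (tag (tagged p)))} :=
  [ffun p => let g := tagged (tagged p) in
     (T (tag (tagged p)) \o tw_act F g)%VF - (tw_act F' g \o T (tag p))%VF].

Lemma tw_defect_linear F F' : linear (@tw_defect F F').
Proof.
move=> a T U; apply/ffunP => p; rewrite !ffunE /=.
rewrite comp_lfunDl -comp_lfunZl comp_lfunDr -comp_lfunZr.
by rewrite scalerBr opprD addrACA.
Qed.

Definition twHom (F F' : twrep) : {vspace {dffun forall x : G, 'Hom(F x, F' x)}} :=
  lker (linfun (@tw_defect F F')).

Lemma mem_twHom F F' T : T \in twHom F F' <-> is_intertwiner (fun x => T x).
Proof.
pose dL : {linear _ -> _} := HB.pack (@tw_defect F F')
  (GRing.isLinear.Build _ _ _ _ _ (@tw_defect_linear F F')).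
rewrite memv_ker (lfunE dL) /=; split => [/eqP/ffunP E x y g | E].
  have /eqP := E (existT _ x (existT _ y g)).
  by rewrite !ffunE /= subr_eq0 => /eqP.
by apply/eqP/ffunP => p; rewrite !ffunE /= E subrr.
Qed.

(* Kernels and images of morphisms are computed objectwise. *)
Definition short_exact (F' F F'' : twrep) : Prop :=
  exists (a : forall x, 'Hom(F' x, F x)) (b : forall x, 'Hom(F x, F'' x)),
    [/\ is_intertwiner a, is_intertwiner b &
      forall x, [/\ lker (a x) = 0%VS, limg (a x) = lker (b x)
                  & limg (b x) = fullv]].

Definition is_iso (F F' : twrep) : Prop :=
  exists T : forall x, 'Hom(F x, F' x),
    is_intertwiner T /\ forall x, lker (T x) = 0%VS /\ limg (T x) = fullv.

(* Twisted representations on the spaces C^n. Every twisted representation is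
   isomorphic to one of these ([coordinates_iso]). Unlike [twrep], whose
   elements carry types, [coord_rep] is small enough to be a type of generators
   for the Grothendieck group. *)
Record coord_rep := CoordRep {
  cr_dim : G -> nat;
  cr_act : forall x y, gmor x y -> 'Hom('rV[R[i]]_(cr_dim x), 'rV[R[i]]_(cr_dim y));
  cr_act1 : forall x, cr_act (gid x) = \1%VF;
  cr_actM : forall x y z (g2 : gmor y z) (g1 : gmor x y),
    (cr_act g2 \o cr_act g1)%VF = c2val theta g2 g1 *: cr_act (gcomp g2 g1) }.

HB.instance Definition _ := gen_eqMixin coord_rep.
HB.instance Definition _ := gen_choiceMixin coord_rep.

Coercion twrep_of_coord (E : coord_rep) : twrep :=
  TwRep (@cr_act1 E) (@cr_actM E).

Section Coordinates.
Variable F : twrep.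

Definition coord_map (x : G) : 'Hom(F x, 'rV[R[i]]_(\dim {:F x})) :=
  linfun (rVof (vbasis {:F x})).

Lemma lker_coord_map x : lker (coord_map x) == 0%VS.
Proof.
apply/lker0P => u v; rewrite !lfunE /=.
exact: (can_inj (rVofK (vbasisP _))).
Qed.

Lemma limg_coord_map x : limg (coord_map x) = fullv.
Proof.
apply/eqP; rewrite eqEdim subvf limg_dim_eq ?(eqP (lker_coord_map x)) ?capv0//.
by rewrite dimvf /dim /= mul1n.
Qed.

Lemma coord_mapK x : (coord_map x \o (coord_map x)^-1 = \1)%VF.
Proof.
apply/lfunP => u; rewrite !lfunE /= limg_lfunVK// limg_coord_map memvf//.
Qed.

Definition coord_act x y (g : gmor x y) :=
  (coord_map y \o tw_act F g \o (coord_map x)^-1)%VF.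

Lemma coord_act1 x : coord_act (gid x) = \1%VF.
Proof. by rewrite /coord_act tw_act1 comp_lfun1r coord_mapK. Qed.

Lemma coord_actM x y z (g2 : gmor y z) (g1 : gmor x y) :
  (coord_act g2 \o coord_act g1)%VF = c2val theta g2 g1 *: coord_act (gcomp g2 g1).
Proof.
rewrite /coord_act -!comp_lfunA [X in (_ \o (_ \o X))%VF]comp_lfunA.
rewrite (lker0_compVf (lker_coord_map y)) comp_lfun1l.
by rewrite [X in (_ \o X)%VF]comp_lfunA tw_actM -comp_lfunZl -comp_lfunZr.
Qed.

Definition coordinates : coord_rep := CoordRep coord_act1 coord_actM.

Lemma coordinates_iso : is_iso F coordinates.
Proof.
exists coord_map; split=> [x y g | x].
  rewrite /= /coord_act -!comp_lfunA (lker0_compVf (lker_coord_map x)).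
  by rewrite comp_lfun1r.
by split; [apply/eqP/lker_coord_map | apply: limg_coord_map].
Qed.

End Coordinates.

Lemma is_iso_sym F F' : is_iso F F' -> is_iso F' F.
Proof.
case=> T [Tmor Tbij].
have SK x : cancel (T x) ((T x)^-1)%VF by apply/lker0_lfunK/eqP; case: (Tbij x).
have KS x : cancel ((T x)^-1)%VF (T x).
  by move=> v; rewrite limg_lfunVK// (Tbij x).2 memvf.
exists (fun x => (T x)^-1%VF); split=> [x y g | x].
  apply/lfunP => v; rewrite !comp_lfunE -{1}(KS x v).
  by rewrite -[tw_act F' g (T x _)]comp_lfunE -Tmor comp_lfunE SK.
split; first exact/eqP/lker0P/can_inj/KS.
apply/vspaceP => u; rewrite memvf -(SK x u); exact: memv_img (memvf _).
Qed.

Lemma short_exact_iso F' F F'' E' E E'' :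
  is_iso F' E' -> is_iso F E -> is_iso F'' E'' ->
  short_exact F' F F'' -> short_exact E' E E''.
Proof.
move=> [T' [T'mor T'bij]] [T [Tmor Tbij]] [T'' [T''mor T''bij]].
move=> [a [b [amor bmor ex]]].
have inj (U V : vectType R[i]) (f : 'Hom(U, V)) : lker f = 0%VS -> injective f.
  by move=> f0; apply/lker0P; rewrite f0.
have sur (U V : vectType R[i]) (f : 'Hom(U, V)) v : limg f = fullv ->
    {u | v = f u}.
  by move=> fE; apply: sig_eqW; have : v \in limg f by [rewrite fE memvf];
     move=> /memv_imgP[u _ ->]; exists u.
pose S' x := (T' x)^-1%VF; pose S x := (T x)^-1%VF.
have SK' x : cancel (T' x) (S' x) by apply/lker0_lfunK/eqP; case: (T'bij x).
have SK x : cancel (T x) (S x) by apply/lker0_lfunK/eqP; case: (Tbij x).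
have mor (H K : twrep) (U : forall x, 'Hom(H x, K x)) : is_intertwiner U ->
  forall x y (g : gmor x y) u, U y (tw_act H g u) = tw_act K g (U x u).
  by move=> Umor x y g u; rewrite -!comp_lfunE Umor.
exists (fun x => (T x \o a x \o S' x)%VF), (fun x => (T'' x \o b x \o S x)%VF).
split.
- move=> x y g; apply/lfunP => v; have [u ->] := sur _ _ _ v (T'bij x).2.
  by rewrite !comp_lfunE SK' -(mor _ _ _ T'mor) SK' !(mor _ _ a) ?(mor _ _ T).
- move=> x y g; apply/lfunP => v; have [u ->] := sur _ _ _ v (Tbij x).2.
  by rewrite !comp_lfunE SK -(mor _ _ _ Tmor) SK !(mor _ _ b) ?(mor _ _ T'').
move=> x; have [a0 ab b1] := ex x; split.
- apply/eqP/lker0P => u v; have [u1 ->] := sur _ _ _ u (T'bij x).2.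
  have [v1 ->] := sur _ _ _ v (T'bij x).2; rewrite !comp_lfunE !SK'.
  by move/(inj _ _ _ (Tbij x).1)/(inj _ _ _ a0) => ->.
- apply/vspaceP => v; have [u ->] := sur _ _ _ v (Tbij x).2.
  rewrite memv_ker !comp_lfunE SK.
  rewrite -(linear0 (T'' x)) (inj_eq (inj _ _ _ (T''bij x).1)) -memv_ker.
  rewrite -ab; apply/memv_imgP/memv_imgP => -[w _].
    rewrite !comp_lfunE => /(inj _ _ _ (Tbij x).1) ->; exists (S' x w) => //.
    exact: memvf.
  move=> ->; exists (T' x w); first exact: memvf.
  by rewrite !comp_lfunE SK'.
- apply/vspaceP => v; rewrite memvf; apply/memv_imgP.
  have [u ->] := sur _ _ _ v (T''bij x).2; have [w ->] := sur _ _ _ u b1.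
  by exists (T x w); [exact: memvf | rewrite !comp_lfunE SK].
Qed.

(* The Grothendieck group: one generator per (coordinate) representation and
   the relation [F] = [F'] + [F''] for each exact 0 -> F' -> F -> F'' -> 0.
   Together with [rep_class] it is the universal target of additive invariants
   of arbitrary twisted representations: see [rep_class_ses],
   [rep_class_universal] and [rep_class_ext]. *)
Definition ses_relator (u : {freeg coord_rep / int}) : Prop :=
  exists F' F F'' : coord_rep,
    short_exact F' F F'' /\ u = << F >> - << F' >> - << F'' >>.

Definition Rep : Type := pres ses_relator.
HB.instance Definition _ := GRing.Lmodule.on Rep.

Definition rep_class (F : twrep) : Rep := pres_gen ses_relator (coordinates F).

Lemma rep_class_ses F' F F'' :
  short_exact F' F F'' -> rep_class F = rep_class F' + rep_class F''.
Proof.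
move=> ex; apply/eqP; rewrite -subr_eq0 opprD addrA; apply/eqP.
rewrite /rep_class /pres_gen -!raddfB; apply: pres_rel.
exists (coordinates F'), (coordinates F), (coordinates F''); split=> //.
by apply: (short_exact_iso _ _ _ ex); apply: coordinates_iso.
Qed.

Definition zero_act (x y : G) (g : gmor x y) : 'Hom('rV[R[i]]_0, 'rV[R[i]]_0) := 0.

Lemma zero_act1 x : zero_act (gid x) = \1%VF.
Proof. by apply/lfunP => u; apply/rowP => -[]. Qed.

Lemma zero_actM x y z (g2 : gmor y z) (g1 : gmor x y) :
  (zero_act g2 \o zero_act g1)%VF = c2val theta g2 g1 *: zero_act (gcomp g2 g1).
Proof. by apply/lfunP => u; apply/rowP => -[]. Qed.

Definition zero_rep : coord_rep := @CoordRep (fun=> 0%N) zero_act zero_act1 zero_actM.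

Lemma is_iso_short_exact (F F' : twrep) : is_iso F F' -> short_exact zero_rep F F'.
Proof.
case=> T [Tmor Tbij]; exists (fun=> 0), T; split=> // [x y g | x].
  by rewrite comp_lfun0l comp_lfun0r.
have [T0 ->] := Tbij x; split=> //; last first.
  by rewrite T0; apply/vspaceP=> v; apply/memv_imgP/idP => [[u _ ->]|];
     [rewrite lfunE mem0v | rewrite memv0 => /eqP->; exists 0; rewrite ?mem0v ?linear0].
by apply/eqP/lker0P => u v _; apply/rowP => -[].
Qed.

Lemma pres_gen_rep_class (E : coord_rep) : pres_gen ses_relator E = rep_class E.
Proof.
have idI (F : twrep) : is_iso F F.
  exists (fun=> \1%VF); split=> [x y g|x]; first by rewrite comp_lfun1l comp_lfun1r.
  split; last exact: lim1g.
  by apply/eqP/lker0P => u v; rewrite !lfunE.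
have rel (F' F F'' : coord_rep) : short_exact F' F F'' ->
    pres_gen ses_relator F = pres_gen ses_relator F' + pres_gen ses_relator F''.
  move=> ex; apply/eqP; rewrite -subr_eq0 opprD addrA; apply/eqP.
  by rewrite /pres_gen -!raddfB; apply: pres_rel; exists F', F, F''.
have z0 : pres_gen ses_relator zero_rep = 0.
  apply: (addrI (pres_gen ses_relator zero_rep)); rewrite addr0.
  exact: esym (rel _ _ _ (is_iso_short_exact (idI zero_rep))).
have := rel _ E (coordinates E) (is_iso_short_exact (coordinates_iso E)).
by rewrite z0 add0r.
Qed.

Lemma rep_class_ext (A : zmodType) (f g : {additive Rep -> A}) :
  (forall F, f (rep_class F) = g (rep_class F)) -> f =1 g.
Proof.
move=> fg.
have lin (h : {additive Rep -> A}) : scalable (h : Rep -> zmodule A).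
  by move=> n q; rewrite -[n]intz !scaler_int raddfMz.
pose pk (h : {additive Rep -> A}) : {linear Rep -> zmodule A} :=
  HB.pack (h : Rep -> zmodule A)
    (GRing.isZmodMorphism.Build Rep (zmodule A) h (raddfB h))
    (GRing.isScalable.Build int Rep (zmodule A) *:%R h (lin h)).
apply: (@pres_ext _ _ _ (zmodule A) (pk f) (pk g)) => E.
by rewrite pres_gen_rep_class; apply: fg.
Qed.

Lemma rep_class_universal (A : zmodType) (f : twrep -> A) :
  (forall F' F F'', short_exact F' F F'' -> f F = f F' + f F'') ->
  exists g : {additive Rep -> A}, forall F, g (rep_class F) = f F.
Proof.
move=> f_ses.
have z0 : f zero_rep = 0.
  apply: (addrI (f zero_rep)); rewrite addr0; apply/esym/f_ses/is_iso_short_exact.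
  exists (fun=> \1%VF); split=> [x y g|x]; first by rewrite comp_lfun1l comp_lfun1r.
  by split; [apply/eqP/lker0P => u v; rewrite !lfunE | exact: lim1g].
have [|g gE] := @pres_lift int _ ses_relator (zmodule A) (fun E : coord_rep => f E).
  move=> _ [F' [F [F'' [/f_ses fE ->]]]].
  have L := lift_is_additive (fun E : coord_rep => f E : zmodule A).
  by rewrite !L !liftU !scale1r fE addrAC addrK subrr.
pose gA : {additive Rep -> A} := HB.pack (g : Rep -> A)
  (GRing.isZmodMorphism.Build Rep A g (raddfB g)).
exists gA => F /=.
rewrite gE (f_ses _ _ _ (is_iso_short_exact (coordinates_iso F))).
by rewrite z0 add0r.
Qed.

Definition lftrace (V : vectType R[i]) (f : 'End(V)) : R[i] :=
  \tr (mxof (vbasis {:V}) (vbasis {:V}) f).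

Definition character (F : twrep) (gamma : loop_groupoid G) : R[i] :=
  lftrace (tw_act F (tagged gamma)).

End TwistedRep.

(* Extension of scalars of an abelian group [A] from Z to [S]: the [S]-module
   generated by symbols [1 (x) a], subject to additivity in [a]. *)
Section BaseChange.
Variables (S : nzRingType) (A : zmodType).

Definition additivity_relator (u : {freeg A / S}) : Prop :=
  exists a b : A, u = << a + b >> - << a >> - << b >>.

Definition base_change : Type := pres additivity_relator.
HB.instance Definition _ := GRing.Lmodule.on base_change.

Definition to_base_change (a : A) : base_change := pres_gen additivity_relator a.

Lemma to_base_change_zmod_morphism : zmod_morphism to_base_change.
Proof.
have D a b : to_base_change (a + b) = to_base_change a + to_base_change b.
  apply/eqP; rewrite -subr_eq0 opprD addrA; apply/eqP.
  by rewrite /to_base_change /pres_gen -!raddfB; apply: pres_rel; exists a, b.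
by move=> a b; apply: (addIr (to_base_change b)); rewrite -D !subrK.
Qed.
HB.instance Definition _ := GRing.isZmodMorphism.Build A base_change to_base_change
  to_base_change_zmod_morphism.

Lemma base_change_ext (W : lmodType S) (f g : {linear base_change -> W}) :
  (forall a, f (to_base_change a) = g (to_base_change a)) -> f =1 g.
Proof. exact: pres_ext. Qed.

Lemma base_change_universal (W : lmodType S) (f : {additive A -> W}) :
  exists g : {linear base_change -> W}, forall a, g (to_base_change a) = f a.
Proof.
apply: pres_lift => _ [a [b ->]].
by rewrite !lift_is_additive !liftU !scale1r raddfD addrAC addrK subrr.
Qed.

End BaseChange.

Section Sections.
Variables (R : realType) (H : finGroupoid).

(* Only meaningful for [beta] constant on connected components. *)
Definition integral (beta : H -> R[i]) : R[i] :=
  \sum_(x : H) beta x / #|{: {y : H & gmor x y}}|%:R.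

Variable lambda : cocycle1 R H.

Definition section_pred : {pred {ffun H -> R[i]^o}} := fun s =>
  [forall x : H, forall y : H, forall g : gmor x y, s y == c1val lambda g * s x].

Lemma section_predP (s : {ffun H -> R[i]^o}) :
  reflect (forall x y (g : gmor x y), s y = c1val lambda g * s x)
          (s \in section_pred).
Proof.
apply: (iffP forallP) => [sE x y g | sE x].
  by have /forallP/(_ y)/forallP/(_ g)/eqP := sE x.
by apply/forallP => y; apply/forallP => g; apply/eqP.
Qed.

Lemma section_submod : submod_closed section_pred.
Proof.
split; first by apply/section_predP => x y g; rewrite !ffunE mulr0.
move=> a s t /section_predP sE /section_predP tE; apply/section_predP => x y g.
by rewrite !ffunE (sE _ _ g) (tE _ _ g) mulrDr /GRing.scale /= mulrCA.
Qed.
HB.instance Definition _ := GRing.isSubmodClosed.Build R[i] {ffun H -> R[i]^o}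
  section_pred section_submod.

Record sections := MkSection {
  sec_fun :> {ffun H -> R[i]^o};
  sec_funP : sec_fun \in section_pred }.

HB.instance Definition _ := [isSub for sec_fun].
HB.instance Definition _ := [Choice of sections by <:].
HB.instance Definition _ := [SubChoice_isSubLmodule of sections by <:].

Definition section_ip (s t : sections) : R[i] :=
  integral (fun x => (s x)^* * t x).

End Sections.

(* Conjugate-linear in the first variable, unlike the library's [{dot _ for _}]. *)
Section InnerProducts.
Variables (R : realType) (V : lmodType R[i]).

Record sesquilinear (h : V -> V -> R[i]) : Prop := Sesquilinear {
  sesqDl : forall u u' v, h (u + u') v = h u v + h u' v;
  sesqZl : forall a u v, h (a *: u) v = a^* * h u v;
  sesqDr : forall u v v', h u (v + v') = h u v + h u v';
  sesqZr : forall a u v, h u (a *: v) = a * h u v }.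

Record inner_product (h : V -> V -> R[i]) : Prop := InnerProduct {
  ip_sesq : sesquilinear h;
  ip_conj : forall u v, h v u = (h u v)^*;
  ip_pos : forall u, u != 0 -> 0 < h u u }.
End InnerProducts.

Definition inner_product_iso (R : realType) (V W : lmodType R[i])
    (hV : V -> V -> R[i]) (hW : W -> W -> R[i]) (f : V -> W) : Prop :=
  [/\ inner_product hV, inner_product hW, bijective f
    & forall u v, hW (f u) (f v) = hV u v].

Section RepC.
Variables (R : realType) (G : finGroupoid) (theta : cocycle2 R G).

Definition RepC : Type := base_change R[i] (Rep theta).
HB.instance Definition _ := GRing.Lmodule.on RepC.

Definition classC (F : twrep theta) : RepC := to_base_change _ (rep_class F).

Lemma RepC_ext (W : lmodType R[i]) (f g : {linear RepC -> W}) :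
  (forall F, f (classC F) = g (classC F)) -> f =1 g.
Proof.
move=> fg; apply: base_change_ext => a.
pose k (h : {linear RepC -> W}) : {additive Rep theta -> W} :=
  (h : {additive base_change R[i] (Rep theta) -> W}) \o @to_base_change R[i] (Rep theta).
by apply: (rep_class_ext (f := k f) (g := k g)) => F; apply: fg.
Qed.

(* This determines [h], see [extends_dim_Hom_unique]. *)
Definition extends_dim_Hom (h : RepC -> RepC -> R[i]) : Prop :=
  sesquilinear h /\
  forall F F', h (classC F) (classC F') = (\dim (twHom F F'))%:R.

Lemma extends_dim_Hom_unique h h' :
  extends_dim_Hom h -> extends_dim_Hom h' -> h =2 h'.
Proof.
move=> [hs hE] [h's h'E].
pose r k (ks : sesquilinear k) u : {linear RepC -> R[i]^o} := HB.pack (k u : RepC -> R[i]^o)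
  (GRing.isLinear.Build R[i] RepC R[i]^o *:%R (k u)
     (fun a v w => etrans (sesqDr ks u (a *: v) w) (congr1 (+%R^~ _) (sesqZr ks a u v)))).
have l_lin k (ks : sesquilinear k) v : linear ((fun u => (k u v)^*) : RepC -> R[i]^o).
  by move=> a u w; rewrite (sesqDl ks) (sesqZl ks) rmorphD rmorphM /= conjCK.
pose l k ks v : {linear RepC -> R[i]^o} := HB.pack ((fun u => (k u v)^*) : RepC -> R[i]^o)
  (GRing.isLinear.Build R[i] RepC R[i]^o *:%R _ (l_lin k ks v)).
move=> u v; apply: (@RepC_ext _ (r h hs u) (r h' h's u)) => F' /=.
apply: (can_inj conjCK).
apply: (@RepC_ext _ (l h hs (classC F')) (l h' h's (classC F'))) => F /=.
by rewrite hE h'E.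
Qed.

End RepC.

(* Main.v *)
(* By averaging over the arrows out of each object, every family of linear maps
   F(x) -> F'(x) becomes an intertwiner; the trace of this projector onto
   Hom(F, F') is the inner product of the characters, because F(g) has finite
   order up to a scalar of norm 1 and so tr F(g)^-1 is the conjugate of tr F(g)
   for g an automorphism. Averaging also splits off subrepresentations, so the
   irreducibles span Rep (x) C, and by Schur's lemma an element with character 0
   has all its coefficients 0: the character map is injective. If a section s is
   orthogonal to all characters, then the intertwiner
   sum_g conj(s(g)) F(g) : F(x) -> F(x) is a scalar on each irreducible F, with
   trace 0, hence 0; it then vanishes on every F, and on the regular
   representation this says s = 0. As the space of sections is finite
   dimensional, the characters span it. *)
From HB Require Import structures.
Require Import Defs.
From mathcomp Require Import all_boot all_order all_algebra.
From mathcomp Require Import boolp reals complex freeg separable spectral.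

Set Implicit Arguments.
Unset Strict Implicit.
Unset Printing Implicit Defensive.

Import Order.TTheory GRing.Theory Num.Theory.
Import passmx.
Local Open Scope ring_scope.

(** * Traces *)

Section Trace.
Variable R : realType.
Local Notation C := R[i].
Implicit Types U V W : vectType C.

Lemma lftrace_linear V : linear (@lftrace R V : 'End(V) -> C^o).
Proof. by move=> a f g; rewrite /lftrace !linearP. Qed.

HB.instance Definition _ V :=
  GRing.isLinear.Build C 'End(V) C^o *:%R (@lftrace R V) (@lftrace_linear V).

Lemma lftraceZ V a (f : 'End(V)) : lftrace (a *: f) = a * lftrace f.
Proof. exact: linearZ. Qed.

Lemma lftraceC V W (f : 'Hom(V, W)) (g : 'Hom(W, V)) :
  lftrace (f \o g)%VF = lftrace (g \o f)%VF.
Proof.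
by rewrite /lftrace !(mxof_comp _ _ (vbasisP _)) mxtrace_mulC.
Qed.

Lemma lftrace1 V : lftrace (\1%VF : 'End(V)) = (\dim {:V})%:R.
Proof. by rewrite /lftrace mxof1 ?mxtrace1// (basis_free (vbasisP _)). Qed.

Lemma lftrace_coord V (f : 'End(V)) :
  lftrace f = \sum_j coord (vbasis {:V}) j (f (vbasis {:V})`_j).
Proof.
by apply: eq_bigr => j _; rewrite !mxE/= vecof_delta.
Qed.

(** Insert the resolution of the identity to the right of [f] and rotate each trace. This reads off
    a trace from diagonal blocks, both on a product of Hom spaces and on a single one. *)
Lemma lftrace_decomp V (I : finType) (W : I -> vectType C)
    (J : forall i, 'Hom(V, W i)) (K : forall i, 'Hom(W i, V)) (f : 'End(V)) :
  (\sum_i (K i \o J i) = \1)%VF -> lftrace f = \sum_i lftrace (J i \o (f \o K i))%VF.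
Proof.
move=> KJ1; rewrite -[f in LHS]comp_lfun1r -KJ1.
have -> : (f \o \sum_i (K i \o J i) = \sum_i ((f \o K i) \o J i))%VF.
  apply/lfunP => v; rewrite comp_lfunE !sum_lfunE linear_sum.
  by apply: eq_bigr => i _; rewrite !comp_lfunE.
by rewrite linear_sum; apply: eq_bigr => i _; rewrite lftraceC.
Qed.

(** [p] factors through [U] as inclusion after corestriction, and in the opposite order these
    compose to the identity of [U]; cyclicity of the trace concludes. *)
Lemma lftrace_idem V (U : {vspace V}) (p : 'End(V)) :
  (forall v, p v \in U) -> (forall v, v \in U -> p v = v) ->
  lftrace p = (\dim U)%:R.
Proof.
move=> pU pid; pose q : 'Hom(V, subvs_of U) := (linfun (vsproj U) \o p)%VF.
pose j : 'Hom(subvs_of U, V) := linfun vsval.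
have -> : p = (j \o q)%VF.
  by apply/lfunP => v; rewrite !comp_lfunE !lfunE/= vsprojK.
have -> : lftrace (j \o q)%VF = lftrace (\1%VF : 'End(subvs_of U)).
  rewrite lftraceC; congr lftrace; apply/lfunP => v.
  by rewrite !comp_lfunE !lfunE /= pid ?subvsP// vsvalK.
by rewrite lftrace1 dimvf.
Qed.

Lemma lftrace_conj V W (f : 'End(V)) (g : 'End(W)) (i : 'Hom(V, W)) (j : 'Hom(W, V)) :
  (j \o i)%VF = \1%VF -> (i \o f)%VF = (g \o i)%VF -> (i \o j)%VF = \1%VF ->
  lftrace f = lftrace g.
Proof.
move=> ji fg ij; rewrite -[f]comp_lfun1l -ji -comp_lfunA lftraceC fg.
by rewrite -comp_lfunA ij comp_lfun1r.
Qed.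

Lemma linear_hom V W (f : V -> W) : linear f -> {h : 'Hom(V, W) | h =1 f}.
Proof.
move=> fL; pose g : {linear V -> W} := HB.pack f (GRing.isLinear.Build C V W *:%R f fL).
by exists (linfun g) => v; rewrite lfunE.
Qed.

(** Under Hom(V, W) = W (x) V*, [f] is [b] tensored with the transpose of [c]. Cutting Hom(V, W)
    into copies of W by evaluation at basis vectors, the j-th diagonal block is [b] times the j-th
    diagonal entry of [c]. *)
Lemma lftrace_sandwich V W (b : 'End(W)) (c : 'End(V)) (f : 'End('Hom(V, W))) :
  (forall t, f t = (b \o (t \o c))%VF) -> lftrace f = lftrace b * lftrace c.
Proof.
move=> fE; set e := vbasis {:V}.
have Jl (j : 'I_(\dim {:V})) : linear (fun t : 'Hom(V, W) => t e`_j).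
  by move=> a t u; rewrite /= add_lfunE scale_lfunE.
pose J j := sval (linear_hom (Jl j)).
have JE j t : J j t = t e`_j by rewrite /J; case: linear_hom.
have kl (j : 'I_(\dim {:V})) (w : W) : linear (fun v => coord e j v *: w).
  by move=> a v v'; rewrite linearP scalerDl scalerA.
pose k (j : 'I_(\dim {:V})) (w : W) := sval (linear_hom (kl j w)).
have kE j w v : k j w v = coord e j v *: w by rewrite /k; case: linear_hom.
have Kl j : linear (k j).
  move=> a w w'; apply/lfunP => v; rewrite add_lfunE scale_lfunE !kE.
  by rewrite scalerDr !scalerA mulrC.
pose K j := sval (linear_hom (Kl j)).
have KE j w : K j w = k j w by rewrite /K; case: linear_hom.
rewrite (@lftrace_decomp _ _ (fun=> W) J K); last first.
  apply/lfunP => t; apply/lfunP => v; rewrite sum_lfunE sum_lfunE id_lfunE.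
  rewrite [v in RHS](coord_vbasis (memvf v)) linear_sum; apply: eq_bigr => j _.
  by rewrite comp_lfunE KE kE JE linearZ.
rewrite [lftrace c]lftrace_coord mulr_sumr; apply: eq_bigr => j _.
rewrite mulrC -lftraceZ; congr lftrace; apply/lfunP => w.
by rewrite scale_lfunE !comp_lfunE JE fE KE !comp_lfunE kE linearZ.
Qed.

End Trace.

(** * Matrices of finite order up to a scalar of norm 1 *)

Section FiniteOrder.
Variable C : numClosedFieldType.

Lemma separable_Xn_subC m (c : C) : (0 < m)%N -> c != 0 ->
  separable_poly ('X^m - c%:P).
Proof.
move=> m0 c0; have mC : (m%:R : C) != 0 by rewrite pnatr_eq0 -lt0n.
rewrite separable_poly.unlock derivB derivXn derivC subr0.
(* Subtracting [X / m] times the derivative [m X^(m-1)] from the polynomial leaves the nonzero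
   constant [- c]. *)
apply/Bezout_coprimepP; exists (1 : {poly C}, - (m%:R^-1)%:P * 'X) => /=.
have -> : (1 : {poly C}) * ('X^m - c%:P) +
    - (m%:R^-1)%:P * 'X * ('X^(m.-1) *+ m) = (- c)%:P.
  rewrite mul1r -mulrA mulrnAr -exprS prednK// mulNr mul_polyC -scaler_nat scalerA.
  by rewrite mulVf// scale1r addrAC subrr add0r polyCN.
by rewrite -alg_polyC eqp_scale ?oppr_eq0.
Qed.

(** [M] is killed by the separable polynomial [X^m - c], hence diagonalizable; its eigenvalues have
    norm 1, so their inverses are their conjugates. *)
Lemma mxtrace_inv_conj n (M N : 'M[C]_n) m (c : C) :
  N *m M = 1%:M -> (0 < m)%N -> `|c| = 1 ->
  iter m (mulmx M) 1%:M = c%:M -> \tr N = (\tr M)^*.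
Proof.
case: n => [|n] in M N *; first by rewrite /mxtrace !big_ord0 conjC0.
move=> NM m0 c1 Mm; have c0 : c != 0 by rewrite -normr_eq0 c1 oner_eq0.
have MmE : M ^+ m = c%:M.
  by rewrite -Mm; elim: (m) => [|k IH] //=; rewrite exprS IH.
have [P Pu /diagonalizable_forPex[D /simmxPp PM]] : diagonalizable M.
  apply/diagonalizableP.
  have [r rE] := closed_field_poly_normal ('X^m - c%:P).
  rewrite lead_coefDl ?size_polyXn ?size_polyN ?ltnS
    ?(leq_trans (size_polyC_leq1 _))// in rE.
  rewrite lead_coefXn scale1r in rE; exists r.
    by rewrite -separable_prod_XsubC -rE separable_Xn_subC.
  rewrite -rE; apply: mxminpoly_min.
  by rewrite rmorphB rmorphXn /= horner_mx_X horner_mx_C MmE subrr.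
have {}PM : P *m M = diag_mx D *m P by apply: PM; rewrite stablemx_unit.
have PMk k : P *m M ^+ k = diag_mx (\row_i D 0 i ^+ k) *m P.
  elim: k => [|k IH].
    rewrite expr0 mulmx1 (_ : diag_mx _ = 1%:M) ?mul1mx//.
    by apply/matrixP => i j; rewrite !mxE expr0.
  rewrite exprS [M * _]/(M *m _) mulmxA PM -mulmxA IH mulmxA; congr (_ *m _).
  by apply/matrixP => i j; rewrite mul_diag_mx !mxE exprS mulrnAr.
have D1 i : `|D 0 i| = 1.
  have /matrixP/(_ i i) : diag_mx (\row_i D 0 i ^+ m) = c%:M :> 'M_n.+1.
    apply: (can_inj (mulmxK Pu)); rewrite -PMk MmE.
    by rewrite scalar_mxC.
  rewrite !mxE eqxx !mulr1n => /(congr1 Num.norm)/eqP.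
  by rewrite c1 normrX pexpr_eq1 ?normr_ge0// => /eqP.
have trP (A : 'M_n.+1) : \tr (P *m A *m invmx P) = \tr A.
  by rewrite mxtrace_mulC mulmxA mulVmx// mul1mx.
have MD : P *m M *m invmx P = diag_mx D by rewrite PM mulmxK.
have ED : (P *m N *m invmx P) *m diag_mx D = 1%:M.
  by rewrite -MD !mulmxA mulmxKV// -[P *m N *m M]mulmxA NM mulmx1 mulmxV.
rewrite -(trP N) -(trP M) MD mxtrace_diag rmorph_sum; apply: eq_bigr => i _.
have /matrixP/(_ i i) := ED; rewrite mul_mx_diag mxE [RHS]mxE eqxx mulr1n => Ei.
have D0 : D 0 i != 0 by rewrite -normr_eq0 D1 oner_eq0.
by apply: (mulIf D0); rewrite -[RHS]mulrC -normCK D1 expr1n -Ei.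
Qed.
End FiniteOrder.

(** * Averaging over arrows *)

Section Averaging.
Variables (R : realType) (G : finGroupoid) (theta : cocycle2 R G).
Implicit Types F : twrep theta.
Local Notation C := R[i].

Definition star (y : G) : finType := {x : G & gmor y x}.

Definition star_comp (y z : G) (h : gmor y z) (p : star z) : star y :=
  Tagged (gmor y) (gcomp (tagged p) h).

Lemma star_comp_bij y z (h : gmor y z) : bijective (star_comp h).
Proof.
exists (star_comp (ginv h)) => -[x g]; rewrite /star_comp /= -gcompA.
  by rewrite gcompgV gcompg1.
by rewrite gcompVg gcompg1.
Qed.

Lemma card_star y z (h : gmor y z) : #|star y| = #|star z|.
Proof. exact/esym/(bij_eq_card (star_comp_bij h)). Qed.

Lemma card_star_neq0 y : (#|star y|%:R : C) != 0.
Proof.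
by rewrite pnatr_eq0 -lt0n; apply/card_gt0P; exists (Tagged (gmor y) (gid y) : star y).
Qed.

(* Not the action of [ginv g], from which it differs by a scalar. *)
Definition tw_inv F x y (g : gmor x y) : 'Hom(F y, F x) := (tw_act F g)^-1%VF.

Lemma tw_act_app F x y z (g2 : gmor y z) (g1 : gmor x y) v :
  tw_act F g2 (tw_act F g1 v) = c2val theta g2 g1 *: tw_act F (gcomp g2 g1) v.
Proof. by rewrite -comp_lfunE tw_actM scale_lfunE. Qed.

Lemma tw_act_ginv F x y (g : gmor x y) v :
  tw_act F (ginv g) (tw_act F g v) = c2val theta (ginv g) g *: v.
Proof. by rewrite tw_act_app gcompVg tw_act1 id_lfunE. Qed.

Lemma tw_actK F x y (g : gmor x y) : cancel (tw_act F g) (tw_inv F g).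
Proof.
apply: lker0_lfunK; apply/lker0P => u v /(congr1 (tw_act F (ginv g))).
by rewrite !tw_act_ginv; apply/scalerI/c2_neq0.
Qed.

(** Surjectivity of F(g): up to the nonzero scalar [c2val theta g (ginv g)], [v] is F(g) applied to
    F(g^-1) v. *)
Lemma tw_invK F x y (g : gmor x y) : cancel (tw_inv F g) (tw_act F g).
Proof.
move=> v; apply: limg_lfunVK.
rewrite -[v](scalerK (c2_neq0 theta g (ginv g))).
have -> : c2val theta g (ginv g) *: v = tw_act F g (tw_act F (ginv g) v).
  by rewrite tw_act_app gcompgV tw_act1 id_lfunE.
by rewrite memvZ// memv_img// memvf.
Qed.

Lemma tw_inv_app F x y z (g2 : gmor y z) (g1 : gmor x y) v :
  tw_inv F (gcomp g2 g1) v = c2val theta g2 g1 *: tw_inv F g1 (tw_inv F g2 v).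
Proof.
apply: (can_inj (tw_actK (gcomp g2 g1))); rewrite tw_invK linearZ /=.
by rewrite -tw_act_app !tw_invK.
Qed.

Variables F F' : twrep theta.

Definition avg (T : forall x, 'Hom(F x, F' x)) (y : G) : 'Hom(F y, F' y) :=
  #|star y|%:R^-1 *: \sum_(p : star y)
    (tw_inv F' (tagged p) \o (T (tag p) \o tw_act F (tagged p)))%VF.

Lemma avgE T y v : avg T y v = #|star y|%:R^-1 *: \sum_(p : star y)
    tw_inv F' (tagged p) (T (tag p) (tw_act F (tagged p) v)).
Proof.
rewrite scale_lfunE sum_lfunE; congr (_ *: _).
by apply: eq_bigr => p _; rewrite !comp_lfunE.
Qed.

(** Reindex the average at [y] by precomposition with [h]. Both sides then carry the same factor
    [c2val theta p h]: one from composing actions of [F], the other from the inverse action of [F']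
    on a composite. *)
Lemma avg_intertwiner T : is_intertwiner (avg T).
Proof.
move=> y z h; apply/lfunP => v; rewrite !comp_lfunE !avgE (card_star h).
rewrite [RHS]linearZ [X in _ = _ *: X]linear_sum /=; congr (_ *: _).
rewrite [RHS](reindex _ (onW_bij _ (star_comp_bij h))); apply: eq_bigr => p _ /=.
by rewrite tw_inv_app linearZ /= tw_invK tw_act_app !linearZ.
Qed.

Lemma avg_id T : is_intertwiner T -> forall y, avg T y = T y.
Proof.
move=> TT y; apply/lfunP => v; rewrite avgE.
have H (p : star y) : true ->
    tw_inv F' (tagged p) (T (tag p) (tw_act F (tagged p) v)) = T y v.
  by move=> _; rewrite -[T _ (tw_act _ _ _)]comp_lfunE TT comp_lfunE tw_actK.
rewrite (eq_bigr _ H) sumr_const -[X in _ *: X]scaler_nat scalerA mulVf ?scale1r//.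
exact: card_star_neq0.
Qed.
End Averaging.

(** * The trace of F(g)^-1 for an automorphism g *)

Section CharacterInverse.
Variable R : realType.
Local Notation C := R[i].

Lemma lftrace_inv_conj (V : vectType C) (f g : 'End(V)) m (c : C) :
  cancel f g -> (0 < m)%N -> `|c| = 1 -> (forall v, iter m f v = c *: v) ->
  lftrace g = (lftrace f)^*.
Proof.
move=> fK m0 c1 fm; rewrite /lftrace; set e := vbasis _.
have eb : basis_of fullv e := vbasisP _.
apply: (mxtrace_inv_conj (m := m) (c := c)) => //.
  apply: mulmx1C; rewrite -(mxof_comp _ _ eb) -(mxof1 (basis_free eb)).
  by congr mxof; apply/lfunP => v; rewrite comp_lfunE id_lfunE fK.
pose h k : 'End(V) := iter k (fun h => h \o f)%VF \1%VF.
have hE k v : h k v = iter k f v.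
  elim: k v => [|k IH] v; first by rewrite id_lfunE.
  by rewrite iterSr -IH /h iterS comp_lfunE.
have -> : iter m (mulmx (mxof e e f)) 1%:M = mxof e e (h m).
  elim: (m) => [|k IH]; first by rewrite /h /= (mxof1 (basis_free eb)).
  by rewrite iterS IH -(mxof_comp _ _ eb).
have -> : h m = c *: \1%VF by apply/lfunP => v; rewrite hE fm scale_lfunE id_lfunE.
by rewrite linearZ /= (mxof1 (basis_free eb)) scalemx1.
Qed.

Variables (G : finGroupoid) (theta : cocycle2 R G).
Implicit Types F : twrep theta.

(** F(g)^k is a scalar of norm 1 times F(g^k). Two powers of [g] coincide by the pigeonhole
    principle, so F(g)^j is a multiple of F(g)^i, and F(g)^i can be cancelled. *)
Lemma tw_act_finite_order F x (g : gmor x x) :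
  exists m (c : C), [/\ (0 < m)%N, `|c| = 1 & forall v, iter m (tw_act F g) v = c *: v].
Proof.
pose gp k := iter k (gcomp g) (gid x).
have gpE k : {c : C | `|c| = 1 &
    forall v, iter k (tw_act F g) v = c *: tw_act F (gp k) v}.
  elim: k => [|k [c c1 IH]].
    by exists 1; [exact: normr1 | move=> v; rewrite /= tw_act1 id_lfunE scale1r].
  exists (c * c2val theta g (gp k)); first by rewrite normrM c1 c2_norm mulr1.
  by move=> v; rewrite /= IH linearZ /= tw_act_app scalerA.
have [i [j [ij gij]]] : exists i j, (i < j)%N /\ gp i = gp j.
  have /injectivePn[i [j nij gij]] :
      ~~ injectiveb (fun i : 'I_(#|{: gmor x x}|.+1) => gp i).
    apply/negP => /injectiveP/leq_card; rewrite card_ord ltnn//.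
  have [lij|lji|/val_inj eij] := ltngtP i j; first by exists i, j.
    by exists j, i.
  by rewrite eij eqxx in nij.
have [ci ci1 iE] := gpE i; have [cj cj1 jE] := gpE j.
have ci0 : ci != 0 by rewrite -normr_eq0 ci1 oner_eq0.
exists (j - i)%N, (cj / ci); split; first by rewrite subn_gt0.
  by rewrite normf_div ci1 cj1 divr1.
move=> v; have iter_inj : injective (iter i (tw_act F g)).
  by elim: (i) => [|k IH] u w //= /(can_inj (@tw_actK _ _ _ F _ _ g))/IH.
apply: iter_inj; rewrite -iterD subnKC; last exact: ltnW.
by rewrite jE iE -gij linearZ /= scalerA mulrCA mulfV ?mulr1.
Qed.

Lemma lftrace_tw_inv F x (g : gmor x x) :
  lftrace (tw_inv F g) = (lftrace (tw_act F g))^*.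
Proof.
have [m [c [m0 c1 E]]] := tw_act_finite_order F g.
exact: lftrace_inv_conj (@tw_actK _ _ _ F _ _ g) m0 c1 E.
Qed.
End CharacterInverse.

(** * Inner products of characters as dimensions of Hom spaces *)

Section DimHom.
Variables (R : realType) (G : finGroupoid) (theta : cocycle2 R G).
Implicit Types F : twrep theta.
Local Notation C := R[i].

(** An arrow out of a loop is an arrow of [G] out of its base point, since conjugation determines
    the target loop. *)
Lemma card_loop_star (a : loop_groupoid G) :
  #|{: {b : loop_groupoid G & gmor a b}}| = #|star (tag a)|.
Proof.
pose f (p : {b : loop_groupoid G & gmor a b}) : star (tag a) :=
  Tagged (gmor (tag a)) (val (tagged p)).
pose k (q : star (tag a)) : loop_groupoid G :=
  Tagged (fun x => gmor x x) (gcomp (gcomp (tagged q) (tagged a)) (ginv (tagged q))).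
pose h (q : star (tag a)) : {b : loop_groupoid G & gmor a b} :=
  Tagged (gmor a) (exist _ (tagged q) (eqxx _) : loop_mor a (k q)).
(* The target loop [b] is kept as a variable, so that the proof [gP] can be used to substitute for
   it. *)
have fK (y : G) (b : gmor y y) (g : gmor (tag a) y)
    (gP : gcomp (gcomp g (tagged a)) (ginv g) == b)
    (p : {b : loop_groupoid G & gmor a b}) :
    p = Tagged (gmor a) (exist _ g gP : loop_mor a (Tagged (fun x => gmor x x) b)) ->
  h (f p) = p.
  move=> ->; have Eb := eqP gP; subst b.
  by rewrite /h /f /=; congr existT; apply: val_inj.
apply: (bij_eq_card (f := f)); exists h => [p|[x g] //].
by case Ep: p => [[y b] [g gP]]; rewrite -Ep; apply: fK Ep.
Qed.

Lemma integral_loop (beta : loop_groupoid G -> C) :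
  integral beta = \sum_(x : G) #|star x|%:R^-1 *
    \sum_(g : gmor x x) beta (Tagged (fun x => gmor x x) g).
Proof.
rewrite /integral (eq_bigr (fun a : {x : G & gmor x x} =>
  beta a / #|star (tag a)|%:R)); last first.
  by move=> a _; rewrite card_loop_star.
transitivity (\sum_(x : G) \sum_(g : gmor x x)
    beta (Tagged (fun x => gmor x x) g) / #|star x|%:R).
  by rewrite sig_big_dep; apply: eq_bigr => -[x g].
by apply: eq_bigr => x _; rewrite mulr_sumr; apply: eq_bigr => g _; rewrite mulrC.
Qed.

Section Avg.
Variables F F' : twrep theta.
Local Notation homV := {dffun forall x : G, 'Hom(F x, F' x)}.

Definition avg_fun (T : homV) : homV := [ffun x => avg T x].

Lemma avg_fun_linear : linear avg_fun.
Proof.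
move=> a T U; apply/ffunP => y; rewrite !ffunE; apply/lfunP => v.
rewrite add_lfunE (scale_lfunE a (avg T y)) !avgE [X in _ = X + _]scalerA [a * _]mulrC.
rewrite -[X in _ = X + _]scalerA -[RHS]scalerDr; congr (_ *: _).
rewrite scaler_sumr -big_split; apply: eq_bigr => p _ /=.
by rewrite !ffunE add_lfunE scale_lfunE linearP.
Qed.

Definition proj_at (x : G) (T : homV) : 'Hom(F x, F' x) := T x.

Lemma proj_at_linear x : linear (proj_at x).
Proof. by move=> a T U; rewrite /proj_at !ffunE. Qed.

Definition inj_at (x : G) (t : 'Hom(F x, F' x)) : homV :=
  [ffun y => dfwith (fun y => 0 : 'Hom(F y, F' y)) t y].

Arguments inj_at : clear implicits.

Lemma inj_at_in x t : inj_at x t x = t.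
Proof. by rewrite ffunE dfwith_in. Qed.

Lemma inj_at_out x y t : x != y -> inj_at x t y = 0.
Proof. by move=> xy; rewrite ffunE dfwith_out. Qed.

Lemma inj_at_linear x : linear (inj_at x).
Proof.
move=> a t u; apply/ffunP => y; rewrite !ffunE.
have [<-|xy] := eqVneq x y; first by rewrite !dfwith_in.
by rewrite !dfwith_out// scaler0 addr0.
Qed.

(** Two computations of the trace of the averaging operator on the product of the Hom(F(x), F'(x)):
    as a projector onto [twHom F F'], and as a sum over its diagonal blocks. *)
Lemma character_ip_dim_Hom :
  \sum_(x : G) #|star x|%:R^-1 *
    (\sum_(g : gmor x x) (lftrace (tw_act F' g))^* * lftrace (tw_act F g))
  = (\dim (twHom F F'))%:R :> C.
Proof.
have [P PE] := linear_hom avg_fun_linear.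
rewrite -(lftrace_idem (U := twHom F F') (p := P)); first last.
- move=> T /mem_twHom TT; rewrite PE; apply/ffunP => x; rewrite ffunE.
  exact: avg_id.
- move=> T; rewrite PE; apply/mem_twHom => x y g.
  by rewrite !ffunE; apply: avg_intertwiner.
pose J x := sval (linear_hom (proj_at_linear x)).
have JE x T : J x T = T x by rewrite /J; case: linear_hom.
pose K x := sval (linear_hom (@inj_at_linear x)).
have KE x t : K x t = inj_at x t by rewrite /K; case: linear_hom.
rewrite (lftrace_decomp (W := fun x => 'Hom(F x, F' x)) (J := J) (K := K)); last first.
  apply/lfunP => T; apply/ffunP => y; rewrite sum_lfunE id_lfunE.
  have -> : (\sum_x (K x \o J x)%VF T) y = \sum_x ((K x \o J x)%VF T) y.
    by rewrite -JE linear_sum; apply: eq_bigr => x _; rewrite /= JE.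
  rewrite (bigD1 y)//= big1 ?addr0 => [|x xy]; rewrite comp_lfunE KE JE.
    by rewrite inj_at_in.
  by rewrite inj_at_out.
apply: eq_bigr => x _.
have Sl (g : gmor x x) : linear (fun t => tw_inv F' g \o (t \o tw_act F g))%VF.
  move=> a t u; apply/lfunP => v.
  by rewrite !comp_lfunE add_lfunE !scale_lfunE add_lfunE scale_lfunE !comp_lfunE linearP.
pose S g := sval (linear_hom (Sl g)).
have SE g t : S g t = (tw_inv F' g \o (t \o tw_act F g))%VF.
  by rewrite /S; case: linear_hom.
(* A family supported at [x] is seen only by arrows ending at [x], so of all arrows out of [x] the
   diagonal block retains the automorphisms. *)
have -> : (J x \o (P \o K x))%VF = #|star x|%:R^-1 *: \sum_g S g.
  apply/lfunP => t; rewrite !comp_lfunE JE PE KE ffunE scale_lfunE sum_lfunE.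
  congr (_ *: _); transitivity (\sum_(z : G) \sum_(g : gmor x z)
    (tw_inv F' g \o (inj_at x t z \o tw_act F g))%VF).
    by rewrite sig_big_dep; apply: eq_bigr => -[].
  rewrite (bigD1 x)//= [X in _ + X]big1 ?addr0 => [|z zx].
    by apply: eq_bigr => g _; rewrite SE inj_at_in.
  rewrite big1 // => g _; rewrite inj_at_out 1?eq_sym//.
  by rewrite comp_lfun0l comp_lfun0r.
rewrite lftraceZ linear_sum; congr (_ * _); apply: eq_bigr => g _.
by rewrite /= (lftrace_sandwich (SE g)) lftrace_tw_inv.
Qed.
End Avg.

Lemma section_ip_character F F' (s s' : sections (transgression theta)) :
  (forall a, s a = character F a) -> (forall a, s' a = character F' a) ->
  section_ip s s' = (\dim (twHom F F'))%:R.
Proof.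
(* The pairing of sections conjugates the character of [F], the trace formula that of [F']; a
   dimension equals its own conjugate. *)
move=> sE s'E; rewrite -[RHS]conjC_nat -character_ip_dim_Hom rmorph_sum.
rewrite /section_ip integral_loop; apply: eq_bigr => x _.
rewrite rmorphM fmorphV /= conjC_nat rmorph_sum; congr (_ * _); apply: eq_bigr => g _.
by rewrite rmorphM /= conjCK sE s'E mulrC.
Qed.

End DimHom.

(** * Subrepresentations *)

Section Subreps.
Variables (R : realType) (G : finGroupoid) (theta : cocycle2 R G).
Local Notation C := R[i].

Definition tw_stable (F : twrep theta) (U : forall x, {vspace F x}) : Prop :=
  forall x y (g : gmor x y) v, v \in U x -> tw_act F g v \in U y.

Definition irreducible (F : twrep theta) : Prop :=
  (exists x, \dim {:F x} != 0%N) /\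
  forall U : forall x, {vspace F x}, tw_stable U ->
    (forall x, U x = 0%VS) \/ (forall x, U x = fullv).

Section Subrep.
Variables (F : twrep theta) (U : forall x, {vspace F x}).
Hypothesis Uinv : tw_stable U.

Definition sub_act x y (g : gmor x y) : 'Hom(subvs_of (U x), subvs_of (U y)) :=
  (linfun (vsproj (U y)) \o (tw_act F g \o linfun vsval))%VF.

Lemma sub_actE x y (g : gmor x y) v : vsval (sub_act g v) = tw_act F g (vsval v).
Proof. by rewrite !comp_lfunE !lfunE /= vsprojK// Uinv// subvsP. Qed.

Lemma sub_act1 x : sub_act (gid x) = \1%VF.
Proof.
apply/lfunP => v; apply: subvs_inj; rewrite sub_actE tw_act1 id_lfunE.
by rewrite id_lfunE.
Qed.

Lemma sub_actM x y z (g2 : gmor y z) (g1 : gmor x y) :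
  (sub_act g2 \o sub_act g1)%VF = c2val theta g2 g1 *: sub_act (gcomp g2 g1).
Proof.
apply/lfunP => v; apply: subvs_inj.
by rewrite comp_lfunE scale_lfunE [RHS]linearZ /= !sub_actE tw_act_app.
Qed.

Definition subrep : twrep theta := TwRep sub_act1 sub_actM.

Lemma subrep_actE x y (g : gmor x y) v :
  vsval (tw_act subrep g v) = tw_act F g (vsval v).
Proof. exact: sub_actE. Qed.

Lemma dim_subrep x : \dim {:subrep x} = \dim (U x).
Proof. by rewrite dimvf. Qed.

(** F(g)^-1 is a scalar multiple of F(g^-1), which preserves [U]. *)
Lemma tw_stable_inv x y (g : gmor x y) v : v \in U y -> tw_inv F g v \in U x.
Proof.
move=> vU; have := Uinv (ginv g) vU; rewrite -{1}[v](tw_invK g) tw_act_ginv.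
by move=> /(memvZ (c2val theta (ginv g) g)^-1); rewrite scalerK ?c2_neq0.
Qed.

Lemma maschke : exists p : forall x, 'End(F x), [/\ is_intertwiner p,
  (forall x v, p x v \in U x) & (forall x v, v \in U x -> p x v = v)].
Proof.
exists (avg (fun x => projv (U x))); split; first exact: avg_intertwiner.
  move=> x v; rewrite avgE memvZ// memv_suml// => q _.
  by rewrite tw_stable_inv// memv_proj.
move=> x v vU; rewrite avgE (eq_bigr (fun=> v)) => [|q _]; last first.
  by rewrite projv_id ?Uinv// tw_actK.
rewrite sumr_const -[X in _ *: X]scaler_nat scalerA mulVf ?scale1r//.
exact: card_star_neq0.
Qed.

End Subrep.

(** Induction on the total dimension, splitting a reducible representation by [maschke]. The last
    case offers two forms of the splitting: the exact sequence serves identities between classes,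
    the pointwise decomposition serves operators on F(x). *)
Lemma twrep_ind (P : twrep theta -> Prop) :
  (forall F : twrep theta, (forall x, \dim {:F x} = 0%N) -> P F) ->
  (forall F, irreducible F -> P F) ->
  (forall (F : twrep theta) (U V : forall x, {vspace F x})
     (Uinv : tw_stable U) (Vinv : tw_stable V),
     (forall x v, exists u w, [/\ u \in U x, w \in V x & v = u + w]) ->
     short_exact (subrep Uinv) F (subrep Vinv) ->
     P (subrep Uinv) -> P (subrep Vinv) -> P F) ->
  forall F, P F.
Proof.
move=> P0 Pirr Psum F.
have [n] := ubnP (\sum_(x : G) \dim {:F x})%N; elim: n F => // n IH F Fn.
have [F0|/existsNP[x0 /eqP Fx0]] := EM (forall x, \dim {:F x} = 0%N); first exact: P0.
have [Firr|] := EM (irreducible F); first exact: Pirr.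
move=> /not_andP[/(_ (ex_intro _ x0 Fx0))//|].
move=> /existsNP[U /not_implyP[Uinv /not_orP[/existsNP[x Ux] /existsNP[y Uy]]]].
have [p [pmor pU pid]] := maschke Uinv.
pose V x := lker (p x).
have Vinv : tw_stable V.
  move=> a b g v; rewrite !memv_ker => /eqP pv.
  by rewrite -comp_lfunE pmor comp_lfunE pv linear0.
(* A stable family that is proper at a single object already has smaller total dimension. *)
have sub_dim (W : forall x, {vspace F x}) (Winv : tw_stable W) z :
    W z <> fullv -> P (subrep Winv).
  move=> /eqP Wz; apply: IH; rewrite ltnS in Fn; apply: leq_trans Fn.
  rewrite (eq_bigr _ (fun x _ => dim_subrep Winv x)) (bigD1 z)//= [leqRHS](bigD1 z)//=.
  rewrite -addSn leq_add// ?leq_sum// => [|a _]; last exact/dimvS/subvf.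
  by rewrite ltnNge; apply: contra Wz => le_dim; rewrite eqEdim subvf.
apply: (Psum F U V Uinv Vinv).
- move=> z v; exists (p z v), (v - p z v).
  by rewrite pU memv_ker linearB/= (pid _ _ (pU _ _)) subrr addrC subrK.
- pose a z : 'Hom(subrep Uinv z, F z) := linfun vsval.
  (* The complementary projector [1 - p], corestricted to the kernel of [p], is the quotient map by
     [U]. *)
  pose b z : 'Hom(F z, subrep Vinv z) := (linfun (vsproj (V z)) \o (\1 - p z))%VF.
  have aE z v : a z v = vsval v by rewrite lfunE.
  have bE z v : vsval (b z v) = v - p z v.
    rewrite comp_lfunE lfunE /= add_lfunE opp_lfunE id_lfunE vsprojK//.
    by rewrite memv_ker linearB/= (pid _ _ (pU _ _)) subrr.
  exists a, b; split=> [z t g|z t g|z].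
  + by apply/lfunP => v; rewrite [LHS]comp_lfunE [RHS]comp_lfunE !aE subrep_actE.
  + apply/lfunP => v; apply: subvs_inj.
    rewrite [in LHS]comp_lfunE [in RHS]comp_lfunE subrep_actE !bE linearB/=.
    by rewrite -[p t _]comp_lfunE pmor comp_lfunE.
  split.
  + by apply/eqP/lker0P => u v; rewrite !aE; apply: subvs_inj.
  + apply/vspaceP => v; rewrite memv_ker -(inj_eq subvs_inj) bE linear0 subr_eq0.
    apply/memv_imgP/eqP => [[u _ ->]|->]; first by rewrite aE pid// subvsP.
    exists (vsproj (U z) (p z v)); rewrite ?memvf//.
    exact/esym/(etrans (aE _ _))/vsprojK/pU.
  + apply/vspaceP => v; rewrite memvf; apply/memv_imgP; exists (vsval v).
      exact: memvf.
    apply: subvs_inj; rewrite bE; have := subvsP v; rewrite memv_ker => /eqP ->.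
    by rewrite subr0.
- exact: sub_dim Uy.
(* If [V x] were everything, [p x] would vanish; but it fixes [U x], which is nonzero. *)
apply: (sub_dim V Vinv x) => Vx; apply: Ux; apply/eqP; rewrite -subv0.
apply/subvP => v vU; have : v \in V x by rewrite Vx memvf.
by rewrite memv_ker pid// memv0.
Qed.
End Subreps.

(** * The character map *)

Section SectionForm.
Variables (R : realType) (H : finGroupoid) (lambda : cocycle1 R H).
Local Notation C := R[i].
Implicit Types s t : sections lambda.

Lemma sectionD s t x : (s + t) x = s x + t x.
Proof. by rewrite ffunE. Qed.

Lemma sectionZ a s x : (a *: s) x = a * s x.
Proof. by rewrite ffunE. Qed.

Lemma sectionP s t : (forall x, s x = t x) -> s = t.
Proof. by move=> st; apply: val_inj; apply/ffunP. Qed.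

Lemma section_ip_inner_product : inner_product (@section_ip R H lambda).
Proof.
split; first split.
- move=> u u' v; rewrite -big_split; apply: eq_bigr => x _ /=.
  by rewrite sectionD rmorphD !mulrDl.
- move=> a u v; rewrite mulr_sumr; apply: eq_bigr => x _ /=.
  by rewrite sectionZ rmorphM !mulrA.
- move=> u v v'; rewrite -big_split; apply: eq_bigr => x _ /=.
  by rewrite sectionD mulrDr mulrDl.
- move=> a u v; rewrite mulr_sumr; apply: eq_bigr => x _ /=.
  by rewrite sectionZ mulrCA !mulrA.
- move=> u v; rewrite rmorph_sum; apply: eq_bigr => x _ /=.
  by rewrite !rmorphM /= conjCK fmorphV /= rmorph_nat [u x * _]mulrC.
move=> u u0.
have t0 x : 0 <= (u x)^* * u x / #|{: {y : H & gmor x y}}|%:R.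
  by rewrite divr_ge0 ?ler0n// mulrC mul_conjC_ge0.
rewrite lt_neqAle sumr_ge0 ?andbT//; apply: contra u0.
rewrite eq_sym psumr_eq0 => [/allP ux0|x _]; last exact: t0.
apply/eqP/sectionP => x; have := ux0 x (mem_index_enum x).
rewrite /= !mulf_eq0 conjC_eq0 orbb invr_eq0 pnatr_eq0.
have -> : (#|{: {y : H & gmor x y}}| == 0)%N = false.
  apply/negP => /eqP/card0_eq/(_ (Tagged (gmor x) (gid x))); by rewrite inE.
by rewrite orbF => /eqP ->; rewrite ffunE.
Qed.
End SectionForm.

Section CharacterMap.
Variables (R : realType) (G : finGroupoid) (theta : cocycle2 R G).
Local Notation C := R[i].
Implicit Types F : twrep theta.

(** Conjugation by F(g) carries F(gamma) to F(g gamma g^-1) up to a scalar, and that scalar is the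
    transgression of [theta]. *)
Lemma character_section F :
  [ffun a => character F a] \in section_pred (transgression theta).
Proof.
apply/section_predP => a b g; rewrite !ffunE -lftraceZ.
apply/esym/(lftrace_conj (i := tw_act F (val g)) (j := tw_inv F (val g))).
- by apply/lfunP => v; rewrite comp_lfunE id_lfunE tw_actK.
- apply/lfunP => v; rewrite !comp_lfunE scale_lfunE linearZ /= !tw_act_app.
  by rewrite scalerA divfK ?c2_neq0// -loop_morE.
- by apply/lfunP => v; rewrite comp_lfunE id_lfunE tw_invK.
Qed.

Definition char_section F : sections (transgression theta) :=
  MkSection (character_section F).

Lemma char_sectionE F a : char_section F a = character F a.
Proof. by rewrite ffunE. Qed.

Lemma char_section_ses F' F F'' :
  short_exact F' F F'' -> char_section F = char_section F' + char_section F''.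
Proof.
move=> [a [b [amor bmor ex]]]; apply: sectionP => -[x g].
rewrite sectionD !char_sectionE /character /=.
have [a0 ab b1] := ex x.
set f := tw_act F g; set f' := tw_act F' g; set f'' := tw_act F'' g.
(* A linear splitting at the object [x]: [s] is a section of [b x], and [r] a retraction of [a x],
   because [1 - s b] takes values in the image of [a x]. The trace of [f] is then that of its two
   diagonal blocks. *)
pose s := (b x)^-1%VF; pose r := ((a x)^-1 \o (\1 - (s \o b x)))%VF.
have bs : (b x \o s = \1)%VF.
  by apply/lfunP => v; rewrite comp_lfunE id_lfunE limg_lfunVK// b1 memvf.
have ba v : b x (a x v) = 0.
  by apply/eqP; rewrite -memv_ker -ab memv_img ?memvf.
have ra : (r \o a x = \1)%VF.
  apply/lfunP => v; rewrite !comp_lfunE add_lfunE opp_lfunE id_lfunE comp_lfunE.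
  by rewrite ba linear0 subr0 id_lfunE lker0_lfunK ?a0.
have ar : ((a x \o r) + (s \o b x) = \1)%VF.
  apply/lfunP => v; rewrite add_lfunE !comp_lfunE limg_lfunVK.
    by rewrite add_lfunE opp_lfunE comp_lfunE subrK.
  rewrite ab memv_ker add_lfunE opp_lfunE id_lfunE comp_lfunE linearB /=.
  by rewrite -[b x (s _)]comp_lfunE bs id_lfunE subrr.
rewrite -[f]comp_lfun1l -ar comp_lfunDl linearD /=; congr (_ + _).
  rewrite -comp_lfunA lftraceC -comp_lfunA /f -amor comp_lfunA.
  by rewrite ra comp_lfun1l.
by rewrite -comp_lfunA lftraceC bmor -comp_lfunA bs comp_lfun1r.
Qed.

Lemma char_map_exists :
  exists chi : {linear RepC theta -> sections (transgression theta)},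
    forall F, chi (classC F) = char_section F.
Proof.
have [f fE] := rep_class_universal char_section_ses.
have [g gE] := base_change_universal f.
by exists g => F; rewrite -fE -gE.
Qed.

(** The form on [RepC] can therefore be obtained by pulling back the one on sections along [chi]. *)
Lemma extends_dim_Hom_char (chi : {linear RepC theta -> sections (transgression theta)}) :
  (forall F, chi (classC F) = char_section F) ->
  extends_dim_Hom (fun u v => section_ip (chi u) (chi v)).
Proof.
move=> chiE; have [ip_s _ _] := section_ip_inner_product (transgression theta).
split; last first.
  move=> F F'; rewrite !chiE; apply: section_ip_character; exact: char_sectionE.
by split=> *; rewrite ?linearD ?linearZ /= ?(sesqDl ip_s) ?(sesqZl ip_s)
  ?(sesqDr ip_s) ?(sesqZr ip_s).
Qed.

End CharacterMap.

(** * Injectivity of the character map *)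

Lemma pres_ind (S : nzRingType) (X : choiceType) (A : {freeg X / S} -> Prop)
    (P : pres A -> Prop) :
  P 0 -> (forall a u v, P u -> P v -> P (a *: u + v)) ->
  (forall x, P (pres_gen A x)) -> forall u, P u.
Proof.
move=> P0 PL Pgen u; have [v ->] := quot_pi_surj u.
have -> : quot_pi A v = \sum_(x <- dom v) coeff x v *: pres_gen A x.
  rewrite -[v in LHS]freeg_sumE raddf_sum; apply: eq_bigr => x _ /=.
  by rewrite -quot_pi_scalable freegZ_gen mulr1.
elim: (dom v) => [|x l IH]; first by rewrite big_nil.
by rewrite big_cons; apply: PL.
Qed.

Section Injectivity.
Variables (R : realType) (G : finGroupoid) (theta : cocycle2 R G).
Local Notation C := R[i].
Implicit Types F S : twrep theta.

Lemma is_iso_refl F : is_iso F F.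
Proof.
exists (fun=> \1%VF); split=> [x y g|x]; first by rewrite comp_lfun1l comp_lfun1r.
by split; [apply/eqP/lker0P => u v; rewrite !id_lfunE | exact: lim1g].
Qed.

(** The kernels and the images of [T] are stable families; as [T] is nonzero, irreducibility leaves
    only zero kernels and full images. *)
Lemma schur S S' (T : {dffun forall x : G, 'Hom(S x, S' x)}) :
  irreducible S -> irreducible S' -> T \in twHom S S' -> T != 0 -> is_iso S S'.
Proof.
move=> [_ irrS] [_ irrS'] /mem_twHom Tmor T0; exists (fun x => T x); split=> //.
have Tg x y (g : gmor x y) v : T y (tw_act S g v) = tw_act S' g (T x v).
  by rewrite -!comp_lfunE Tmor.
have [x [v Tv]] : exists x v, T x v <> 0.
  apply: contrapT => N; case/eqP: T0; apply/ffunP => x; apply/lfunP => v.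
  rewrite ffunE zero_lfunE; apply: contrapT => Txv; apply: N; by exists x, v.
have [||ker0] := irrS (fun x => lker (T x)).
- by move=> y z g w; rewrite !memv_ker Tg => /eqP ->; rewrite linear0.
- have [||img0] := irrS' (fun x => limg (T x)).
  + by move=> y z g _ /memv_imgP[w _ ->]; rewrite -Tg memv_img ?memvf.
  + move=> img0; case: Tv; apply/eqP; rewrite -memv0 -(img0 x).
    by rewrite memv_img ?memvf.
  + by move=> ker0 y; split.
by case: Tv; apply/eqP; rewrite -memv_ker ker0 memvf.
Qed.

Lemma dim_twHom_irr S : irreducible S -> (\dim (twHom S S) != 0)%N.
Proof.
move=> [[x Sx] _]; rewrite dimv_eq0; apply/negP => /eqP hom0.
pose I : {dffun forall x : G, 'Hom(S x, S x)} := [ffun=> \1%VF].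
have : I \in twHom S S.
  by apply/mem_twHom => y z g; rewrite !ffunE comp_lfun1l comp_lfun1r.
rewrite hom0 memv0 => /eqP/ffunP/(_ x); rewrite !ffunE => id0.
case/negP: Sx; rewrite dimv_eq0 -subv0; apply/subvP => v _.
by rewrite memv0 -[v]id_lfunE id0 zero_lfunE.
Qed.

Lemma dim_twHom_noniso S S' :
  irreducible S -> irreducible S' -> ~ is_iso S S' -> (\dim (twHom S S') = 0)%N.
Proof.
move=> irrS irrS' nSS'; apply/eqP; rewrite dimv_eq0; apply: contrapT => /negP hom0.
apply: nSS'; apply: (schur irrS irrS' (memv_pick (twHom S S'))).
by rewrite vpick0.
Qed.

Lemma classC_ses F' F F'' : short_exact F' F F'' -> classC F = classC F' + classC F''.
Proof. by move=> /rep_class_ses FE; rewrite /classC FE raddfD. Qed.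

Lemma classC_dim0 F : (forall x, \dim {:F x} = 0%N) -> classC F = 0.
Proof.
move=> F0; have all_eq x (U V : {vspace F x}) : U = V.
  have dim0 (W : {vspace F x}) : W = 0%VS.
    by apply/eqP; rewrite -dimv_eq0 -leqn0 -(F0 x) dimvS ?subvf.
  by rewrite (dim0 U) (dim0 V).
(* With all spaces zero, 0 -> F -> F -> F -> 0 is exact, so the class of [F] is its own double. *)
apply: (addrI (classC F)); rewrite addr0; apply/esym/classC_ses.
exists (fun=> \1%VF), (fun=> \1%VF); split.
- by move=> x y g; rewrite comp_lfun1l comp_lfun1r.
- by move=> x y g; rewrite comp_lfun1l comp_lfun1r.
by move=> x; split; apply: all_eq.
Qed.

Lemma classC_iso F F' : is_iso F F' -> classC F = classC F'.
Proof.
move=> /is_iso_short_exact/classC_ses ->; rewrite classC_dim0 ?add0r// => x.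
by rewrite dimvf.
Qed.

(** Isomorphic representations may occur several times in the list, so a zero combination need not
    have zero coefficients. *)
Definition comb (l : seq (C * twrep theta)) : RepC theta :=
  \sum_(p <- l) p.1 *: classC p.2.

Definition irr_list (l : seq (C * twrep theta)) : bool :=
  all (fun p => `[< irreducible p.2 >]) l.

Lemma comb_irr_linear a l l' : irr_list l -> irr_list l' ->
  exists2 m, irr_list m & comb m = a *: comb l + comb l'.
Proof.
move=> irrl irrl'; exists ([seq (a * p.1, p.2) | p <- l] ++ l').
  by rewrite /irr_list all_cat all_map; apply/andP.
rewrite /comb big_cat big_map scaler_sumr; congr (_ + _).
by apply: eq_bigr => p _; rewrite scalerA.
Qed.

Lemma RepC_comb (u : RepC theta) : exists2 l, irr_list l & comb l = u.
Proof.
have nilE : exists2 l, irr_list l & comb l = 0 by exists [::]; rewrite // /comb big_nil.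
have lin a (v w : RepC theta) : (exists2 l, irr_list l & comb l = v) ->
    (exists2 l, irr_list l & comb l = w) -> exists2 l, irr_list l & comb l = a *: v + w.
  by move=> [l irrl <-] [m irrm <-]; apply: comb_irr_linear.
have classE F : exists2 l, irr_list l & comb l = classC F.
  elim/twrep_ind: F => [F F0|F irrF|F U V Uinv Vinv _ ex HU HV].
  - by rewrite classC_dim0.
  - exists [:: (1, F)]; first by rewrite /irr_list /= andbT; apply/asboolP.
    by rewrite /comb big_seq1 scale1r.
  by rewrite (classC_ses ex) -[classC _]scale1r; apply: lin.
(* Two nested inductions: over [R[i]] on the generators of the base change, then over the integers
   on the generators of [Rep theta]. *)
move: u; apply: pres_ind => // a; move: a; apply: pres_ind => [|n a b Ha Hb|E].
- by rewrite [pres_gen _ _](raddf0 (@to_base_change C (Rep theta))).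
- have -> : pres_gen (@additivity_relator C (Rep theta)) (n *: a + b) =
     n%:~R *: to_base_change C a + to_base_change C b.
    rewrite -[LHS]/(to_base_change C (n *: a + b)) raddfD /=; congr (_ + _).
    by rewrite -[n in LHS]intz scaler_int raddfMz scaler_int.
  exact: lin.
by rewrite pres_gen_rep_class; apply: classE.
Qed.

Lemma char_map_injective (chi : {linear RepC theta -> sections (transgression theta)}) :
  (forall F, chi (classC F) = char_section F) -> forall u, chi u = 0 -> u = 0.
Proof.
move=> chiE u; have [l irrl <-] := RepC_comb u.
have [ip_s dimE] := extends_dim_Hom_char chiE.
set ip := (fun _ _ => _) in ip_s dimE.
have {}dimE F F' : ip (classC F) (classC F') = (\dim (twHom F F'))%:R := dimE F F'.
(* Induction on the length of the list, which drops because the first entry is among the terms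
   removed. *)
have [n] := ubnP (size l); elim: n l irrl => // n IH [|[c0 S0] l'] irrl.
  by rewrite /comb big_nil.
set l := _ :: l' in irrl *; move=> ln chi0.
have irrS0 : irreducible S0 by move: irrl => /= /andP[/asboolP].
pose b (p : C * twrep theta) := `[< is_iso S0 p.2 >].
have ipE m : irr_list m ->
    ip (classC S0) (comb m) = (\sum_(p <- m | b p) p.1) * (\dim (twHom S0 S0))%:R.
  elim: m => [_|[c S] m IHm /= /andP[/asboolP irrS /IHm {}IHm]].
    by rewrite /comb !big_nil -[X in ip _ X](scale0r 0) (sesqZr ip_s) !mul0r.
  rewrite /comb !big_cons (sesqDr ip_s) (sesqZr ip_s) -/(comb m) IHm /b /=.
  case: asboolP => [isoS|nisoS].
    by rewrite mulrDl -(classC_iso isoS) dimE.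
  by rewrite dimE dim_twHom_noniso// mulr0 add0r.
(* The pairing of the combination with its first irreducible isolates the total
   coefficient of that isomorphism class, whose terms can then be dropped. *)
have sum0 : \sum_(p <- l | b p) p.1 = 0.
  apply/eqP; have /eqP := ipE l irrl.
  have -> : ip (classC S0) (comb l) = ip (classC S0) 0 by rewrite /ip chi0 linear0.
  rewrite -[X in ip _ X](scale0r 0) (sesqZr ip_s) mul0r.
  by rewrite eq_sym mulf_eq0 pnatr_eq0 (negPf (dim_twHom_irr irrS0)) orbF.
have combE : comb l = comb (filter (predC b) l).
  rewrite /comb big_filter [LHS](bigID b) /= -[RHS]add0r; congr (_ + _).
  transitivity ((\sum_(p <- l | b p) p.1) *: classC S0).
    by rewrite scaler_suml; apply: eq_bigr => p /asboolP/classC_iso <-.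
  by rewrite sum0 scale0r.
rewrite combE in chi0 *; apply: IH chi0; first by
  rewrite /irr_list all_filter; apply: sub_all irrl => p /= ->; rewrite implybT.
have bS0 : b (c0, S0) by apply/asboolP/is_iso_refl.
by rewrite size_filter /= bS0 add0n (leq_ltn_trans (count_size _ _)).
Qed.
End Injectivity.

(** * Surjectivity of the character map *)

Section Surjectivity.
Variable R : realType.
Local Notation C := R[i].

(** Take a subspace inside [P] of the largest possible dimension: adjoining a further vector of [P]
    cannot enlarge it. *)
Lemma submod_vspace (E : vectType C) (P : E -> Prop) :
  P 0 -> (forall a u v, P u -> P v -> P (a *: u + v)) ->
  exists U : {vspace E}, forall v, v \in U <-> P v.
Proof.
move=> P0 PL.
pose Q (n : nat) :=
  `[< exists U : {vspace E}, (forall v, v \in U -> P v) /\ \dim U = n >].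
have Q0 : Q 0%N.
  by apply/asboolP; exists 0%VS; split=> [v|]; rewrite ?dimv0// memv0 => /eqP ->.
have Qle n : Q n -> (n <= \dim {:E})%N.
  by move=> /asboolP[U [_ <-]]; apply/dimvS/subvf.
have exQ : exists n, Q n by exists 0%N.
have [n /asboolP[U [UP Un]] nmax] := ex_maxnP exQ Qle.
exists U => v; split=> [|Pv]; first exact: UP.
have : (\dim (U + <[v]>) <= n)%N.
  apply/nmax/asboolP; exists (U + <[v]>)%VS; split=> // w.
  move=> /memv_addP[u uU [_ /vlineP[a ->] ->]].
  by rewrite addrC; apply: PL => //; apply: UP.
rewrite -Un => le_dim; have : (U == U + <[v]>)%VS by rewrite eqEdim addvSl.
by move=> /eqP ->; rewrite memvE addvSr.
Qed.

(** Dimensions are counted in the ambient space [E] of all functions, where [U1] consists of the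
    sections and [U2] of those in [W]. *)
Lemma section_complement (H : finGroupoid) (lambda : cocycle1 R H)
    (W : sections lambda -> Prop) :
  W 0 -> (forall a s t, W s -> W t -> W (a *: s + t)) ->
  (forall s, (forall t, W t -> section_ip t s = 0) -> s = 0) -> forall s, W s.
Proof.
move=> W0 WL Wperp.
pose E : vectType C := {ffun H -> C^o}.
pose B (f g : E) : C := integral (fun x => (f x)^* * g x).
have BL a f f' g : B (a *: f + f') g = a^* * B f g + B f' g.
  rewrite /B /integral mulr_sumr -big_split; apply: eq_bigr => x _ /=.
  by rewrite !ffunE rmorphD rmorphM /= !mulrDl !mulrA.
have BR f : linear (B f : E -> C^o).
  move=> a g g'; rewrite /B /integral scaler_sumr -big_split; apply: eq_bigr => x _ /=.
  by rewrite !ffunE mulrDr mulrDl mulrCA -!mulrA.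
have [U1 U1P] := @submod_vspace E (fun f => f \in section_pred lambda)
  (section_submod lambda).1 (fun a u v => (section_submod lambda).2 a u v).
have [||U2 U2P] := @submod_vspace E (fun f => exists2 t, W t & f = sec_fun t).
- by exists 0.
- by move=> a _ _ [s Ws ->] [t Wt ->]; exists (a *: s + t) => //; apply: WL.
have U21 : (U2 <= U1)%VS.
  by apply/subvP => f /U2P[t _ ->]; apply/U1P; apply: sec_funP.
suff /eqP U2E : U2 == U1.
  move=> s; have /U1P := sec_funP s; rewrite -U2E => /U2P[t Wt st].
  by have -> : s = t by apply: val_inj.
rewrite eqEdim U21 leqNgt; apply/negP => lt21.
(* Orthogonality to [U2] imposes [\dim U2] equations; on the larger [U1] they have a nonzero
   solution. *)
pose phi (g : E) : 'rV[C]_(\dim U2) := \row_i B (vbasis U2)`_i g.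
have phiL : linear phi.
  by move=> a g g'; apply/rowP => i; rewrite !mxE BR.
have [f fE] := linear_hom phiL.
have : (U1 :&: lker f != 0)%VS.
  apply/eqP => cap0; have := limg_ker_dim f U1; rewrite cap0 dimv0 add0n => dimU1.
  have := dimvS (subvf (f @: U1)%VS); rewrite dimU1 dimvf /dim /= mul1n.
  by rewrite leqNgt lt21.
rewrite -vpick0; set v := vpick _.
have /memv_capP[/U1P vS vker] : v \in (U1 :&: lker f)%VS by apply: memv_pick.
case/eqP; have v0 (i : 'I_(\dim U2)) : B (vbasis U2)`_i v = 0.
  move: vker; rewrite memv_ker fE => /eqP/rowP/(_ i); by rewrite !mxE.
have : MkSection vS = 0.
  apply: Wperp => t Wt; have tU : sec_fun t \in U2 by apply/U2P; exists t.
  rewrite -[section_ip _ _]/(B t v) (coord_vbasis tU).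
  elim/big_rec: _ => [|i w _ Bw]; last by rewrite BL v0 Bw mulr0 addr0.
  by rewrite /B /integral big1// => x _; rewrite ffunE conjC0 !mul0r.
by move=> /(congr1 (@sec_fun _ _ _)).
Qed.

End Surjectivity.

(** * Intertwiners built from sections *)

Section ClassOperator.
Variables (R : realType) (G : finGroupoid) (theta : cocycle2 R G).
Local Notation C := R[i].
Implicit Types F S : twrep theta.
Implicit Types s : sections (transgression theta).

Lemma lfun_eigenvector (V : vectType C) (f : 'End(V)) :
  \dim {:V} != 0%N -> exists a v, v != 0 /\ f v = a *: v.
Proof.
rewrite -lt0n => /(eigenvalue_closed (mxof (vbasis {:V}) (vbasis {:V}) f)).
move=> [a /eigenvalueP[u uE u0]]; exists a, (vecof (vbasis {:V}) u).
by rewrite vecof_eq0 ?vbasisP// (hom_vecof _ (vbasisP _)) uE linearZ.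
Qed.

Definition loop_of x (g : gmor x x) : loop_groupoid G := Tagged (fun x => gmor x x) g.

Definition class_op F s x : 'End(F x) :=
  \sum_(g : gmor x x) (s (loop_of g))^* *: tw_act F g.

Lemma class_opE F s x v :
  class_op F s x v = \sum_(g : gmor x x) (s (loop_of g))^* *: tw_act F g v.
Proof. by rewrite sum_lfunE; apply: eq_bigr => g _; rewrite scale_lfunE. Qed.

Lemma class_op_natural F F' (T : forall x, 'Hom(F x, F' x)) s x v :
  is_intertwiner T -> T x (class_op F s x v) = class_op F' s x (T x v).
Proof.
move=> Tmor; rewrite !class_opE linear_sum; apply: eq_bigr => g _ /=.
by rewrite linearZ /= -[T x (tw_act _ _ _)]comp_lfunE Tmor comp_lfunE.
Qed.

Definition conj_loop (x y : G) (h : gmor x y) (g : gmor x x) : gmor y y :=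
  gcomp (gcomp h g) (ginv h).

Lemma conj_loopE x y (h : gmor x y) g : gcomp (conj_loop h g) h = gcomp h g.
Proof. by rewrite /conj_loop -gcompA gcompVg gcompg1. Qed.

Lemma conj_loop_bij x y (h : gmor x y) : bijective (conj_loop h).
Proof.
exists (fun g => gcomp (ginv h) (gcomp g h)) => g.
  by rewrite conj_loopE gcompA gcompVg gcomp1g.
by rewrite /conj_loop !gcompA gcompgV gcomp1g -gcompA gcompgV gcompg1.
Qed.

Lemma section_conj_loop s x y (h : gmor x y) (g : gmor x x) :
  s (loop_of (conj_loop h g)) =
  c2val theta (conj_loop h g) h / c2val theta h g * s (loop_of g).
Proof.
have /section_predP/(_ (loop_of g) (loop_of (conj_loop h g))) := sec_funP s.
by move=> /(_ (exist _ h (eqxx _))) ->.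
Qed.

(** Reindex by conjugation with [h]. Values of [theta] have norm 1, so conjugating [s] inverts the
    transgression factor, which then turns one cocycle value into the other. This is why [class_op]
    conjugates its coefficients. *)
Lemma class_op_intertwiner F s : is_intertwiner (class_op F s).
Proof.
move=> x y h; apply/lfunP => v; rewrite !comp_lfunE !class_opE linear_sum.
rewrite (reindex _ (onW_bij _ (conj_loop_bij h))); apply: eq_bigr => g _ /=.
rewrite linearZ /= !tw_act_app !scalerA conj_loopE; congr (_ *: _).
rewrite section_conj_loop !rmorphM fmorphV /=.
have conjE (z : C) : `|z| = 1 -> z^* = z^-1.
  by move=> z1; rewrite invC_norm z1 expr1n invr1 mul1r.
rewrite (conjE _ (c2_norm theta (conj_loop h g) h)) (conjE _ (c2_norm theta h g)).
by rewrite invrK mulrC !mulrA mulfV ?c2_neq0// mul1r mulrC.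
Qed.

Lemma class_op_trace F s :
  \sum_(x : G) #|star x|%:R^-1 * lftrace (class_op F s x)
  = section_ip s (char_section F).
Proof.
rewrite /section_ip integral_loop; apply: eq_bigr => x _; congr (_ * _).
rewrite linear_sum; apply: eq_bigr => g _ /=.
by rewrite lftraceZ char_sectionE.
Qed.

Lemma class_op_eq0 s : (forall F, section_ip s (char_section F) = 0) ->
  forall F x, class_op F s x = 0.
Proof.
move=> s_perp; elim/twrep_ind => [F F0|F [[x0 Fx0] irrF]|F U V Uinv Vinv UV _ HU HV] x.
- apply/lfunP => v; have : v \in fullv by apply: memvf.
  have /eqP -> : {:F x}%VS == 0%VS by rewrite -dimv_eq0 F0.
  by rewrite memv0 => /eqP ->; rewrite !linear0.
- have [a [v [v0 vE]]] := lfun_eigenvector (class_op F s x0) Fx0.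
  (* The eigenvalue found at [x0] is used at every object; since the operator is an intertwiner,
     these eigenspaces form a stable family, nonzero at [x0]. *)
  pose U x := lker (class_op F s x - a *: \1)%VF.
  have UE y w : (w \in U y) = (class_op F s y w == a *: w).
    by rewrite memv_ker add_lfunE opp_lfunE scale_lfunE id_lfunE subr_eq0.
  have [||Ufull] := irrF U.
  + move=> y z g w; rewrite !UE => /eqP wE.
    by rewrite -comp_lfunE class_op_intertwiner comp_lfunE wE linearZ.
  + move=> /(_ x0) U0; case/negP: v0.
    by rewrite -memv0 -U0 UE vE.
  have opE y : class_op F s y = a *: \1%VF.
    apply/lfunP => w; rewrite scale_lfunE id_lfunE; apply/eqP.
    by rewrite -UE Ufull memvf.
  suff a0 : a = 0 by rewrite opE a0 scale0r.
  (* The weighted trace is [a] times a sum of nonnegative terms whose term at [x0] is positive. *)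
  have /eqP := class_op_trace F s; rewrite s_perp.
  rewrite (eq_bigr (fun y => a * ((\dim {:F y})%:R / #|star y|%:R)))
    => [|y _]; last first.
    by rewrite opE lftraceZ lftrace1 mulrC -mulrA.
  rewrite -mulr_sumr mulf_eq0 => /orP[/eqP //|].
  rewrite psumr_eq0 => [/allP/(_ x0 (mem_index_enum x0))|y _]; last first.
    by rewrite divr_ge0 ?ler0n.
  by rewrite mulf_eq0 invr_eq0 pnatr_eq0 (negPf Fx0) (negPf (card_star_neq0 _ _)).
apply/lfunP => v; have [u [w [uU wV ->]]] := UV x v; rewrite zero_lfunE.
(* The inclusion of a subrepresentation is an intertwiner, so the operator of [F] restricts to that
   of the subrepresentation. *)
have sub0 (W : forall x, {vspace F x}) (Winv : tw_stable W) :
    (forall x, class_op (subrep Winv) s x = 0) ->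
  forall w, w \in W x -> class_op F s x w = 0.
  move=> op0 z zW; pose j y : 'Hom(subrep Winv y, F y) := linfun vsval.
  have jE y b : j y b = vsval b by rewrite lfunE.
  have j_mor : is_intertwiner j.
    move=> y t g; apply/lfunP => b.
    by rewrite [LHS]comp_lfunE [RHS]comp_lfunE !jE subrep_actE.
  have := class_op_natural s (vsproj (W x) z : subrep Winv x) j_mor.
  by rewrite op0 zero_lfunE linear0 jE vsprojK.
by rewrite linearD /= (sub0 U Uinv)// (sub0 V Vinv)// addr0.
Qed.

(** * The twisted regular representation on functions on the arrows out of [x0] *)

Section RegularRep.
Variable x0 : G.

Lemma ginv_comp (x y z : G) (g2 : gmor y z) (g1 : gmor x y) :
  ginv (gcomp g2 g1) = gcomp (ginv g1) (ginv g2).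
Proof.
have E : gcomp (gcomp g2 g1) (gcomp (ginv g1) (ginv g2)) = gid z.
  by rewrite gcompA -[gcomp (gcomp g2 g1) _]gcompA gcompgV gcompg1 gcompgV.
by rewrite -[LHS]gcompg1 -E gcompA gcompVg gcomp1g.
Qed.

(* The delta function at h goes to theta(g, h) times the one at g h. *)
Definition reg_fun x y (g : gmor x y) (f : {ffun gmor x0 x -> C^o}) :
    {ffun gmor x0 y -> C^o} :=
  [ffun k => c2val theta g (gcomp (ginv g) k) * f (gcomp (ginv g) k)].

Lemma reg_fun_linear x y (g : gmor x y) : linear (reg_fun g).
Proof.
move=> a f f'; apply/ffunP => k; rewrite !ffunE mulrDr; congr (_ + _).
exact: mulrCA.
Qed.

Definition reg_act x y (g : gmor x y) := sval (linear_hom (reg_fun_linear g)).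

Lemma reg_actE x y (g : gmor x y) : reg_act g =1 reg_fun g.
Proof. by rewrite /reg_act; case: linear_hom. Qed.

Lemma ginv_id (x : G) : ginv (gid x) = gid x :> gmor x x.
Proof. by rewrite -[LHS]gcomp1g gcompgV. Qed.

Lemma reg_act1 x : reg_act (gid x) = \1%VF.
Proof.
apply/lfunP => f; rewrite reg_actE id_lfunE; apply/ffunP => k.
by rewrite ffunE ginv_id gcomp1g c2_1g mul1r.
Qed.

(** The cocycle identity for the triple [g2], [g1] and [g1^-1 g2^-1 k]. *)
Lemma reg_actM x y z (g2 : gmor y z) (g1 : gmor x y) :
  (reg_act g2 \o reg_act g1)%VF = c2val theta g2 g1 *: reg_act (gcomp g2 g1).
Proof.
apply/lfunP => f; rewrite comp_lfunE scale_lfunE !reg_actE; apply/ffunP => k.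
rewrite !ffunE ginv_comp -gcompA mulrA [RHS]mulrA; congr (_ * _).
have := c2_cocycleE theta g2 g1 (gcomp (ginv g1) (gcomp (ginv g2) k)).
have -> : gcomp g1 (gcomp (ginv g1) (gcomp (ginv g2) k)) = gcomp (ginv g2) k.
  by rewrite gcompA gcompgV gcomp1g.
by rewrite mulrC => ->; apply: mulrC.
Qed.

Definition regular_rep : twrep theta := TwRep reg_act1 reg_actM.

End RegularRep.

Lemma section_eq0 s : (forall F, section_ip s (char_section F) = 0) -> s = 0.
Proof.
move=> s_perp; apply: sectionP => -[x g]; rewrite ffunE.
have := class_op_eq0 s_perp (regular_rep x) x.
(* The delta function at the identity: as [theta] is normalized, the operator sends it to the
   function with value [(s g)^*] at [g]. *)
pose e : {ffun gmor x x -> C^o} := [ffun k => (k == gid x)%:R].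
move=> /lfunP/(_ e); rewrite class_opE zero_lfunE => /ffunP/(_ g).
rewrite sum_ffunE [RHS]ffunE (bigD1 g)//= big1 ?addr0 => [|h hg].
  rewrite ffunE reg_actE !ffunE gcompVg c2_g1 eqxx !mulr1 => /eqP.
  by rewrite scaler_eq0 oner_eq0 orbF conjC_eq0 => /eqP.
rewrite ffunE reg_actE !ffunE; have [hg1|] := eqVneq; last by rewrite !mulr0 ?scaler0.
by case/eqP: hg; rewrite -[h]gcompg1 -hg1 gcompA gcompgV gcomp1g.
Qed.

End ClassOperator.

Theorem theorem11 (R : realType) (G : finGroupoid) (theta : cocycle2 R G) :
  exists (ip : RepC theta -> RepC theta -> R[i])
         (chi : {linear RepC theta -> sections (transgression theta)}),
    [/\ extends_dim_Hom ip,
        forall (F : twrep theta) (gamma : loop_groupoid G),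
          chi (classC F) gamma = character F gamma
      & inner_product_iso ip (@section_ip R _ (transgression theta)) chi].
Proof.
have [chi chiE] := char_map_exists theta.
have ipE := extends_dim_Hom_char chiE.
have [s_ip s_conj s_pos] := section_ip_inner_product (transgression theta).
exists (fun u v => section_ip (chi u) (chi v)), chi; split=> // [F gamma|].
  by rewrite chiE char_sectionE.
have chi_inj : injective chi.
  move=> u v uv; apply/eqP; rewrite -subr_eq0; apply/eqP.
  by apply: (char_map_injective chiE); rewrite linearB /= uv subrr.
split=> //.
- split=> [|u v|u u0]; [by case: ipE | exact: s_conj | apply: s_pos].
  by rewrite -(linear0 chi) (inj_eq chi_inj).
(* The image of [chi] is closed under linear combinations, and a section orthogonal to it is
   orthogonal to every character. *)
have chi_surj : forall s, exists u, chi u = s.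
  apply: section_complement => [|a s t [u <-] [v <-]|s s_perp].
  - by exists 0; rewrite linear0.
  - by exists (a *: u + v); rewrite linearP.
  apply: section_eq0 => F; rewrite s_conj -chiE s_perp ?conjC0//.
  by exists (classC F).
exists (fun s => sval (cid (chi_surj s))) => [u|s]; last by case: cid.
by apply: chi_inj; case: cid.
Qed.
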